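(* Let $\omega\in\mathcal{W}$, let $\Omega=\{\Omega^l:l>0\}$ with $\Omega^l_j:=\exp(\frac1l\varphi^*_\omega(lj))$, and let $[\cdot]$ denote one fixed type, Roumieu $\{\cdot\}$ or Beurling $(\cdot)$ (the theorem holds for either type). The following are equivalent: (i) There exists $N\in\mathcal{LC}$ with $\mathcal{E}_{[N]}=\mathcal{E}_{[\omega]}=\mathcal{E}_{[\Omega]}$. (ii) $\omega$ satisfies $(\omega_6)$. (iii) There exists $N\in\mathcal{LC}$ such that for each $l>0$ we have $\mathcal{E}_{[\Omega^l]}=\mathcal{E}_{[N]}$, or equivalently $N\approx\Omega^l$. Additionally (when these conditions hold, with $N$ as in (i), (iii)): (a) $N$ and each $\Omega^l$ satisfy (mg). (b) If $\omega$ satisfies $(\omega_2)$, then $\liminf_{p\to\infty}(N_p/p!)^{1/p}>0$, $\liminf_{p\to\infty}(\Omega^l_p/p!)^{1/p}>0$ for all $l>0$, and: $\omega_N$ and each $\omega_{\Omega^l}$ satisfy $(\omega_2)$; $N$ and each $\Omega^l$ satisfy $(\beta_3)$; and $\mathcal{E}_{[\omega_N]}=\mathcal{E}_{[N]}=\mathcal{E}_{[\omega]}=\mathcal{E}_{[\Omega^l]}$ for each $l>0$. If $\omega$ satisfies $(\omega_5)$, then $\lim_{p\to\infty}(N_p/p!)^{1/p}=\infty$, $\lim_{p\to\infty}(\Omega^l_p/p!)^{1/p}=\infty$ for all $l>0$, and $\omega_N$ and each $\omega_{\Omega^l}$ satisfy $(\omega_5)$.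
   Context: $\mathbb{N}=\{0,1,2,\dots\}$. $\mathcal{W}$ is the set of functions $\omega:[0,\infty)\to[0,\infty)$ that are continuous, increasing, vanish on $[0,1]$, tend to $+\infty$, satisfy $\log t=o(\omega(t))$ as $t\to\infty$, are such that $\varphi_\omega:t\mapsto\omega(e^t)$ is convex on $\mathbb{R}$, and satisfy $(\omega_1)$: $\omega(2t)=O(\omega(t))$ as $t\to\infty$. Further conditions: $(\omega_2)$: $\omega(t)=O(t)$ as $t\to\infty$; $(\omega_5)$: $\omega(t)=o(t)$ as $t\to\infty$; $(\omega_6)$: $\exists H\ge1\ \forall t\ge0:\ 2\omega(t)\le\omega(Ht)+H$. Put $\varphi^*_\omega(x):=\sup\{xy-\varphi_\omega(y):y\ge0\}$. $\mathcal{LC}$ is the set of sequences $M=(M_k)_{k\in\mathbb{N}}$ of positive reals with $1=M_0\le M_1$, $M_j^2\le M_{j-1}M_{j+1}$ for $j\ge1$, and $\lim_{k}(M_k)^{1/k}=+\infty$. (mg): $\exists C\ge1\ \forall j,k:\ M_{j+k}\le C^{j+k}M_jM_k$. $(\beta_3)$: with $\mu_k:=M_k/M_{k-1}$, $\exists Q\in\mathbb{N}_{>0}:\ \liminf_{p\to\infty}\mu_{Qp}/\mu_p>1$. $M\preceq N$ means $\sup_{p\ge1}(M_p/N_p)^{1/p}<\infty$, and $M\approx N$ means $M\preceq N$ and $N\preceq M$. Associated function: $\omega_M(t):=\sup_{p\in\mathbb{N}}\log(t^p/M_p)$ for $t>0$, $\omega_M(0):=0$. Classes: for $U\subseteq\mathbb{R}^r$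 non-empty open and smooth $f:U\to\mathbb{R}^s$ put $\|f\|_{M,K,h}:=\sup_{k\in\mathbb{N},x\in K}\|f^{(k)}(x)\|/(h^kM_k)$ and $\|f\|_{\omega,K,l}:=\sup_{k\in\mathbb{N},x\in K}\|f^{(k)}(x)\|/\exp(\frac1l\varphi^*_\omega(lk))$ (Fréchet derivatives, operator norm). $\mathcal{E}_{\{M\}}(U,\mathbb{R}^s)$, $\mathcal{E}_{\{\omega\}}(U,\mathbb{R}^s)$, $\mathcal{E}_{\{\Omega\}}(U,\mathbb{R}^s)$ consist of those $f$ such that for every compact $K\subset U$, respectively $\|f\|_{M,K,h}<\infty$ for some $h>0$; $\|f\|_{\omega,K,l}<\infty$ for some $l>0$; $\|f\|_{\Omega^l,K,h}<\infty$ for some $l,h>0$. The Beurling classes $\mathcal{E}_{(M)},\mathcal{E}_{(\omega)},\mathcal{E}_{(\Omega)}$ are defined with ''for all'' in place of ''for some''. Equality of classes, $\mathcal{E}_\star=\mathcal{E}_{\star'}$, means equality for all non-empty open $U\subseteq \mathbb{R}^r$ and all $r,s$. *)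

(* Defs.v *)
From mathcomp Require Import all_boot all_order all_algebra.
From mathcomp Require Import all_classical all_reals all_analysis.

Set Implicit Arguments.
Unset Strict Implicit.
Unset Printing Implicit Defensive.

Import Order.TTheory GRing.Theory Num.Theory.
Import numFieldNormedType.Exports.

Local Open Scope classical_set_scope.
Local Open Scope ring_scope.

Section WeightFunctions.
Context {R : realType}.
Implicit Types omega : R -> R.

(** A function [0, oo) -> R is represented by a total function R -> R, of which
    only the values on [0, oo) are used. *)

(** Unfolded forms of f = O(g) and f = o(g) at +oo: the Landau notations need a
    canonical filter structure, which [pinfty_nbhs] does not have. *)
Definition bigOy (f g : R -> R) :=
  exists C : R, \forall t \near +oo, `|f t| <= C * `|g t|.

Definition littleoy (f g : R -> R) :=
  forall eps : R, 0 < eps -> \forall t \near +oo, `|f t| <= eps * `|g t|.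

Definition omega1 omega := bigOy (fun t => omega (2 * t)) omega.

Definition omega2 omega := bigOy omega id.

Definition omega5 omega := littleoy omega id.

Definition omega6 omega :=
  exists H : R, 1 <= H /\ forall t : R, 0 <= t -> 2 * omega t <= omega (H * t) + H.

Definition phi omega (t : R) : R := omega (expR t).

Record weight_function omega : Prop := WeightFunction {
  weight_ge0 : forall t : R, 0 <= t -> 0 <= omega t ;
  weight_continuous : {within `[0, +oo[, continuous omega} ;
  weight_nondecreasing : {in `[0, +oo[ &, {homo omega : s t / s <= t}} ;
  weight_eq0 : forall t : R, 0 <= t <= 1 -> omega t = 0 ;
  weight_cvgy : omega t @[t --> +oo] --> +oo ;
  weight_ln : littleoy (@ln R) omega ;
  weight_convex : convex_function (setT : set R^o) (phi omega) ;
  weight_omega1 : omega1 omega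
}.

(** The supremum is finite for x >= 0 as soon as log t = o(omega t). *)
Definition phistar omega (x : R) : R :=
  sup [set x * y - phi omega y | y in [set y : R | 0 <= y]].

Definition Omega omega (l : R) : R^nat :=
  fun j => expR (l^-1 * phistar omega (l * j%:R)).

End WeightFunctions.

Section WeightSequences.
Context {R : realType}.
Implicit Types M N : R^nat.

(** For p = 0 the exponent p^-1 is 0 and the value is 1. *)
Definition nth_roots M : R^nat := fun p => M p `^ (p%:R^-1).

Record LC M : Prop := LCSequence {
  LC_gt0 : forall k, 0 < M k ;
  LC_0 : M 0%N = 1 ;
  LC_01 : M 0%N <= M 1%N ;
  LC_logconvex : forall j, (1 <= j)%N -> M j ^+ 2 <= M j.-1 * M j.+1 ;
  LC_cvgy : nth_roots M @ \oo --> +oo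
}.

Definition mg M :=
  exists C : R, 1 <= C /\ forall j k, M (j + k)%N <= C ^+ (j + k) * M j * M k.

(** The value at k = 0 is irrelevant: only the limit inferior of quotients of
    the mu_k is considered below. *)
Definition quotients M : R^nat := fun k => M k / M k.-1.

Definition beta3 M :=
  exists Q : nat, (0 < Q)%N /\
    (1 < limn_einf (fun p => (quotients M (Q * p)%N / quotients M p)%:E))%E.

Definition preceq M N :=
  (ereal_sup [set (nth_roots (fun k => M k / N k) p)%:E
             | p in [set p : nat | (1 <= p)%N]] < +oo)%E.

Definition equiv_seq M N := preceq M N /\ preceq N M.

Definition over_fact M : R^nat := fun p => M p / (p`!)%:R.

Definition omega_seq M (t : R) : R :=
  if 0 < t then sup [set ln (t ^+ p / M p) | p in [set: nat]] else 0.

End WeightSequences.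

Section Classes.
Context {R : realType}.

Definition enorm {n} (v : 'rV[R]_n) : R := Num.sqrt (\sum_i v 0 i ^+ 2).

(** [frechet f [:: v1; ...; vk] x] is f^(k)(x)(v1, ..., vk), the iterated
    Fréchet derivative evaluated at vectors: f^(k)(x)(v1) is the differential
    at x, in the direction v1, of the L^(k-1)-valued map f^(k-1), and evaluation
    at (v2, ..., vk) commutes with differentiation. *)
Fixpoint frechet {r s} (f : 'rV[R]_r -> 'rV[R]_s) (vs : seq 'rV[R]_r) :
    'rV[R]_r -> 'rV[R]_s :=
  if vs is v :: vs' then fun x => 'd (frechet f vs') x v else f.

(** The spaces L^k(R^r, R^s) being finite-dimensional, a map into them is
    differentiable iff all its evaluations at k vectors are. *)
Definition smooth {r s} (U : set 'rV[R]_r) (f : 'rV[R]_r -> 'rV[R]_s) :=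
  forall vs x, U x -> differentiable (frechet f vs) x.

Definition opnorm {r s} (f : 'rV[R]_r -> 'rV[R]_s) (k : nat) (x : 'rV[R]_r) :
    \bar R :=
  ereal_sup [set (enorm (frechet f vs x))%:E
            | vs in [set vs : seq 'rV[R]_r |
                      size vs = k /\ forall v, v \in vs -> enorm v <= 1]].

Definition weighted_norm {r s} (w : R^nat) (K : set 'rV[R]_r)
    (f : 'rV[R]_r -> 'rV[R]_s) : \bar R :=
  ereal_sup [set (opnorm f k x * ((w k)^-1)%:E)%E
            | k in [set: nat] & x in K].

Definition norm_seq {r s} (M : R^nat) (K : set 'rV[R]_r) (h : R)
    (f : 'rV[R]_r -> 'rV[R]_s) : \bar R :=
  weighted_norm (fun k => h ^+ k * M k) K f.

Definition norm_fun {r s} (omega : R -> R) (K : set 'rV[R]_r) (l : R)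
    (f : 'rV[R]_r -> 'rV[R]_s) : \bar R :=
  weighted_norm (fun k => expR (l^-1 * phistar omega (l * k%:R))) K f.

(** The bracket [.]: Roumieu {.} or Beurling (.) *)
Inductive bracket := Roumieu | Beurling.

Definition quant (b : bracket) (P : R -> Prop) : Prop :=
  match b with
  | Roumieu => exists h, 0 < h /\ P h
  | Beurling => forall h, 0 < h -> P h
  end.

(** A class of maps U -> R^s, for all r, s and U. Maps are extended arbitrarily
    outside U; since U is open, membership only depends on the values on U. *)
Definition map_class :=
  forall r s : nat, set 'rV[R]_r -> set ('rV[R]_r -> 'rV[R]_s).

Definition E_seq (b : bracket) (M : R^nat) : map_class := fun r s U =>
  [set f | smooth U f /\ forall K, compact K -> K `<=` U ->
     quant b (fun h => (norm_seq M K h f < +oo)%E)].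

Definition E_fun (b : bracket) (omega : R -> R) : map_class := fun r s U =>
  [set f | smooth U f /\ forall K, compact K -> K `<=` U ->
     quant b (fun l => (norm_fun omega K l f < +oo)%E)].

Definition E_mat (b : bracket) (W : R -> R^nat) : map_class := fun r s U =>
  [set f | smooth U f /\ forall K, compact K -> K `<=` U ->
     quant b (fun l => quant b (fun h => (norm_seq (W l) K h f < +oo)%E))].

Definition class_eq (E F : map_class) :=
  forall (r s : nat) (U : set 'rV[R]_r), open U -> U !=set0 ->
    E r s U = F r s U.

End Classes.

(* Main.v *)
From HB Require Import structures.
Require Import Defs.
From mathcomp Require Import all_boot all_order all_algebra.
From mathcomp Require Import all_classical all_reals all_analysis.
From mathcomp Require Import ring lra.

Set Implicit Arguments.
Unset Strict Implicit.
Unset Printing Implicit Defensive.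

Import Order.TTheory GRing.Theory Num.Theory.
Import numFieldNormedType.Exports.

Local Open Scope classical_set_scope.
Local Open Scope ring_scope.

(**
Everything is reduced to comparing logarithms of sequences: [preceq M N] means
ln M_p <= ln N_p + O(p + 1), and ln (Omega^l_p) = phistar (l p) / l.

Inclusions of classes are characterized by test functions on the line,
f(x) = sum_j c_j (cos (t_j x) + sin (t_j x)) with c_j, t_j >= 0, for which
|f^(k)| <= 2 sum_j c_j t_j^k everywhere and |f^(k)(0)| = sum_j c_j t_j^k.
In the Roumieu case one extremal function suffices; in the Beurling case a
gliding hump replaces the usual closed graph argument.

By (omega_1), h^k Omega^l_k <= C Omega^(Ll)_k for some L = L(h), whence
E_[omega] = E_[Omega]. By Young duality (omega_6) says that Omega^(2l) is
equivalent to Omega^l; conversely, the equality E_[N] = E_[omega] traps N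
between members of the matrix in such a way that Omega^(4l) is dominated by
Omega^l for some l, which gives (omega_6) back through the biconjugate of phi
(the loss incurred by restricting the supremum to integer multiples of l is
absorbed by log t = o(omega(t)), and the factor 4 leaves room for it).

Moderate growth comes from convexity,
Omega^l_(j+k) <= Omega^(2l)_j Omega^(2l)_k, and (beta_3) from (omega_1) in the form
phistar (Q p) >= Q phistar p + K Q p - c with K arbitrarily large, since under
moderate growth ln mu_p = (ln M_p) / p + O(1).
*)

(** * Termwise differentiation of trigonometric series *)

Section TrigonometricSeries.
Context {R : realType}.

Lemma norm_sub_le_derive (f df : R -> R) (C x y : R) :
  (forall z, is_derive z (1 : R) f (df z)) ->
  (forall z, `|z - x| <= `|y - x| -> `|df z| <= C) ->
  `|f y - f x| <= C * `|y - x|.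
Proof.
move=> fdf dfC.
have cf : forall a b : R, {within `[a, b], continuous f}.
  move=> a b; apply: derivable_within_continuous => z _.
  by have [] := fdf z.
have [xy|yx] := leP x y.
  have [c /itvP cxy ->] := MVT_segment xy (fun z _ => fdf z) (cf x y).
  rewrite normrM ler_wpM2r// dfC// !ger0_norm ?subr_ge0 ?cxy ?xy//.
  by rewrite lerB ?cxy.
have [c /itvP cxy E] := MVT_segment (ltW yx) (fun z _ => fdf z) (cf y x).
rewrite distrC E distrC normrM ler_wpM2r// dfC// distrC [leRHS]distrC.
rewrite !ger0_norm ?subr_ge0 ?cxy ?(ltW yx)//.
by rewrite lerB ?cxy.
Qed.

Lemma is_derive_quadratic (f : R -> R) (C x d : R) :
  (forall h, `|f (x + h) - f x - h * d| <= C * h ^+ 2) -> is_derive x (1 : R) f d.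
Proof.
move=> fC.
have C0 : 0 <= C by have := fC 1; rewrite expr1n mulr1; exact: le_trans.
suff fcvg : h^-1 *: (f (h *: 1 + x) - f x) @[h --> 0^'] --> d.
  by split; [apply/cvg_ex; exists d | apply: cvg_lim].
apply/cvgrPdist_le => e e0.
near=> h.
have h0 : h != 0 by near: h; exact: nbhs_dnbhs_neq.
have heC : `|h| <= e / (C + 1).
  near: h; apply: dnbhs0_le; rewrite divr_gt0//; lra.
rewrite -[d](mulKf h0) /= -mulrBr normrM normfV mulrC ler_pdivrMr ?normr_gt0//.
rewrite distrC [_ *: 1]mulr1 [h + x]addrC.
apply: (le_trans (fC h)); rewrite -(real_normK (num_real h)) expr2 mulrA.
rewrite ler_wpM2r//; have C1 : 0 < C + 1 by lra.
move: heC; rewrite ler_pdivlMr// => heC.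
by apply: le_trans heC; rewrite mulrC ler_wpM2l//; lra.
Unshelve. all: by end_near. Qed.

Definition trig (a b u : R) : R := a * cos u + b * sin u.

Lemma is_derive_trig a b u : is_derive u (1 : R) (trig a b) (trig b (- a) u).
Proof.
have -> : trig a b = a \*: (@cos R) + b \*: (@sin R) by apply/funext.
by apply: is_derive_eq; rewrite /trig/= /GRing.scale/=; ring.
Qed.

Lemma trig_le2 a b u : `|a| <= 1 -> `|b| <= 1 -> `|trig a b u| <= 2.
Proof.
move=> a1 b1; apply: (le_trans (ler_normD _ _)); rewrite !normrM.
have := cos_max u; have := sin_max u.
by have := normr_ge0 a; have := normr_ge0 b; nra.
Qed.

Lemma trig_taylor a b u h : `|a| <= 1 -> `|b| <= 1 ->
  `|trig a b (u + h) - trig a b u - h * trig b (- a) u| <= 2 * h ^+ 2.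
Proof.
move=> a1 b1.
pose r s := trig a b (u + s) - s * trig b (- a) u.
pose dr s := trig b (- a) (u + s) - trig b (- a) u.
have dtrig a' b' s : is_derive s (1 : R) (fun s => trig a' b' (u + s)) (trig b' (- a') (u + s)).
  have -> : (fun s => trig a' b' (u + s)) = trig (trig a' b' u) (trig b' (- a') u).
    by apply/funext => z; rewrite /trig cosD sinD; ring.
  have -> : trig b' (- a') (u + s) = trig (trig b' (- a') u) (- trig a' b' u) s.
    by rewrite /trig cosD sinD; ring.
  exact: is_derive_trig.
have rdr s : is_derive s (1 : R) r (dr s).
  apply: is_deriveB; apply: is_derive_eq.
  by rewrite scaler0 add0r [LHS]mulr1.
have drh s : `|s| <= `|h| -> `|dr s| <= 2 * `|h|.
  move=> sh; rewrite /dr -[X in trig _ _ X - _](addrC s).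
  have := @norm_sub_le_derive (trig b (- a)) (trig (- a) (- b)) 2 u (s + u)
    (is_derive_trig _ _) (fun z _ => trig_le2 z _ _).
  rewrite !normrN addrK => /(_ a1 b1) H; apply: (le_trans H); lra.
have := @norm_sub_le_derive r dr (2 * `|h|) 0 h rdr.
rewrite subr0 -mulrA -expr2 real_normK ?num_real// /r addr0 mul0r subr0.
rewrite addrAC; apply => z; rewrite subr0; exact: drh.
Qed.

Definition bounded_sums (d : R^nat) (B : R) := forall n, \sum_(0 <= j < n) d j <= B.

Lemma cvg_dominated_series (d u : R^nat) (B C : R) : 0 <= C ->
  bounded_sums d B -> (forall j, `|u j| <= C * d j) ->
  cvgn (series u) /\ `|limn (series u)| <= C * B.
Proof.
move=> C0 dB uC.
have nB n : [normed series u] n <= C * B.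
  apply: (@le_trans _ _ (\sum_(0 <= j < n) C * d j)).
    by apply: ler_sum => j _; exact: uC.
  by rewrite -mulr_sumr ler_wpM2l.
have cu : cvgn [normed series u].
  apply: nondecreasing_is_cvgn.
    exact: (@nondecreasing_series _ (fun k => `|u k|) xpredT 0%N).
  by exists (C * B) => _ [n _ <-].
split; first exact: normed_cvg.
apply: (le_trans (lim_series_norm cu)); apply: limr_le => //.
by near=> n; exact: nB.
Unshelve. all: by end_near. Qed.

Variable t : R^nat.
Hypothesis t_ge0 : forall j, 0 <= t j.

Definition trig_series (d : R^nat) (a b x : R) : R :=
  limn (series (fun j => d j * trig a b (t j * x))).

Lemma trig_series_le (d : R^nat) (B a b x : R) : (forall j, 0 <= d j) ->
  bounded_sums d B -> `|a| <= 1 -> `|b| <= 1 ->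
  cvgn (series (fun j => d j * trig a b (t j * x))) /\
  `|trig_series d a b x| <= 2 * B.
Proof.
move=> d0 dB a1 b1; apply: cvg_dominated_series dB _ => // j.
by rewrite normrM ger0_norm// mulrC ler_wpM2r// trig_le2.
Qed.

Lemma is_derive_trig_series (d : R^nat) (B0 B1 B2 a b x : R) :
  (forall j, 0 <= d j) -> bounded_sums d B0 ->
  bounded_sums (fun j => d j * t j) B1 ->
  bounded_sums (fun j => d j * t j ^+ 2) B2 ->
  `|a| <= 1 -> `|b| <= 1 ->
  is_derive x (1 : R) (trig_series d a b)
    (trig_series (fun j => d j * t j) b (- a) x).
Proof.
move=> d0 dB0 dB1 dB2 a1 b1; apply: (@is_derive_quadratic _ (2 * B2)) => h.
have d1 j : 0 <= d j * t j by rewrite mulr_ge0.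
have [c0 _] := trig_series_le (x + h) d0 dB0 a1 b1.
have [c1 _] := trig_series_le x d0 dB0 a1 b1.
have Na1 : `|- a| <= 1 by rewrite normrN.
have [c2 _] := trig_series_le x d1 dB1 b1 Na1.
rewrite /trig_series -lim_seriesB// -[h * _](lim_seriesZ h c2).
have c3 := is_cvg_seriesZ (k := h) c2.
rewrite -lim_seriesB//; last exact: is_cvg_seriesB.
have -> : 2 * B2 * h ^+ 2 = 2 * h ^+ 2 * B2 by ring.
have h2 : 0 <= 2 * h ^+ 2 by rewrite mulr_ge0// sqr_ge0.
apply: (cvg_dominated_series h2 dB2 _).2 => j.
have -> : ((fun j => d j * trig a b (t j * (x + h))) -
   (fun j => d j * trig a b (t j * x)) -
   h *: (fun j => d j * t j * trig b (- a) (t j * x))) j =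
  d j * (trig a b (t j * x + t j * h) - trig a b (t j * x)
    - t j * h * trig b (- a) (t j * x)).
  rewrite -[LHS]/(d j * trig a b (t j * (x + h)) - d j * trig a b (t j * x)
    - h * (d j * t j * trig b (- a) (t j * x))) [t j * (x + h)]mulrDr; ring.
rewrite normrM ger0_norm//.
have := trig_taylor (t j * x) (t j * h) a1 b1.
move=> /(ler_wpM2l (d0 j)) /le_trans; apply; rewrite exprMn; lra.
Qed.

End TrigonometricSeries.

Section TestFunctions.
Context {R : realType}.
Variables (c t : R^nat).
Hypotheses (c_ge0 : forall j, 0 <= c j) (t_ge0 : forall j, 0 <= t j).
Hypothesis ct_bounded : forall k, exists B, bounded_sums (fun j => c j * t j ^+ k) B.

Lemma diff_coord m n (M : 'M[R]_(m, n)) i j :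
  'd (fun N : 'M[R]_(m, n) => N i j : R) M = (fun N => N i j) :> ('M[R]_(m, n) -> R).
Proof.
have flin : linear (fun N : 'M[R]_(m, n) => N i j : R) by move=> a u v; rewrite !mxE.
pose flM := GRing.isLinear.Build _ _ _ _ _ flin.
pose f : {linear 'M[R]_(m, n) -> R} := HB.pack (fun N : 'M[R]_(m, n) => N i j : R) flM.
by rewrite (@diff_lin _ _ _ f)//; exact: coord_continuous.
Qed.

(* Coefficients of [cos] and [sin] in the k-th derivative of [cos + sin]. *)
Fixpoint trig_signs (k : nat) : R * R :=
  if k is k'.+1 then ((trig_signs k').2, - (trig_signs k').1) else (1, 1).

Lemma norm_trig_signs k : `|(trig_signs k).1| = 1 /\ `|(trig_signs k).2| = 1.
Proof.
by elim: k => [|k [IH1 IH2]]; rewrite /= ?normr1 ?normrN//.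
Qed.

Definition test_derivative k : R -> R :=
  trig_series t (fun j => c j * t j ^+ k) (trig_signs k).1 (trig_signs k).2.

Lemma is_derive_test_derivative k x :
  is_derive x (1 : R) (test_derivative k) (test_derivative k.+1 x).
Proof.
have [B0 dB0] := ct_bounded k; have [B1 dB1] := ct_bounded k.+1.
have [B2 dB2] := ct_bounded k.+2; have [s1 s2] := norm_trig_signs k.
have := @is_derive_trig_series _ t t_ge0 (fun j => c j * t j ^+ k) B0 B1 B2
  (trig_signs k).1 (trig_signs k).2 x.
rewrite /test_derivative /=.
have E1 : (fun j => c j * t j ^+ k * t j) = (fun j => c j * t j ^+ k.+1).
  by apply/funext => j; rewrite exprSr mulrA.
have E2 : (fun j => c j * t j ^+ k * t j ^+ 2) = (fun j => c j * t j ^+ k.+2).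
  by apply/funext => j; rewrite -mulrA -exprD addn2.
rewrite E1 E2 s1 s2; apply => // j.
by rewrite mulr_ge0// exprn_ge0.
Qed.

Lemma test_derivative_le k x B : bounded_sums (fun j => c j * t j ^+ k) B ->
  `|test_derivative k x| <= 2 * B.
Proof.
have [s1 s2] := norm_trig_signs k.
have d0 j : 0 <= c j * t j ^+ k by rewrite mulr_ge0// exprn_ge0.
move=> dB; have := trig_series_le t x d0 dB (a := (trig_signs k).1) (b := (trig_signs k).2).
by rewrite s1 s2 => -[].
Qed.

Lemma test_derivative0_ge k j : c j * t j ^+ k <= `|test_derivative k 0|.
Proof.
have [s1 s2] := norm_trig_signs k.
have d0 i : 0 <= c i * t i ^+ k by rewrite mulr_ge0// exprn_ge0.
have [B dB] := ct_bounded k.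
have [cv _] := cvg_dominated_series (u := fun j => c j * t j ^+ k) ler01 dB
  (fun j => ltac:(rewrite mul1r ger0_norm; [exact: lexx | exact: d0])).
rewrite /test_derivative /trig_series.
have -> : (fun i => c i * t i ^+ k * trig (trig_signs k).1 (trig_signs k).2 (t i * 0)) =
   (trig_signs k).1 *: (fun i => c i * t i ^+ k).
  apply/funext => i; rewrite fctE /GRing.scale/= /trig mulr0 cos0 sin0; ring.
rewrite lim_seriesZ// /GRing.scale/= normrM s1 mul1r.
apply: le_trans (ler_norm _).
have nd : nondecreasing_seq (series (fun i => c i * t i ^+ k)).
  exact: nondecreasing_series.
apply: le_trans (nondecreasing_cvgn_le nd cv j.+1).
by rewrite /series/= big_nat_recr//= lerDr sumr_ge0.
Qed.

Definition test_function (x : 'rV[R]_1) : 'rV[R]_1 :=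
  test_derivative 0 (x 0 0) *: const_mx 1.

Lemma frechet_test_functionE vs x : differentiable (frechet test_function vs) x /\
  frechet test_function vs =
  fun x => ((\prod_(v <- vs) v 0 0) * test_derivative (size vs) (x 0 0)) *: const_mx 1.
Proof.
have H p k (y : 'rV[R]_1) :
    differentiable (fun x : 'rV[R]_1 => p * test_derivative k (x 0 0)) y /\
    'd (fun x : 'rV[R]_1 => p * test_derivative k (x 0 0)) y =
    (fun v => v 0 0 * (p * test_derivative k.+1 (y 0 0))) :> ('rV[R]_1 -> R).
  have dg z : is_derive z (1 : R) (p \*: test_derivative k : R -> R) (p * test_derivative k.+1 z).
    apply: is_deriveZ; exact: is_derive_test_derivative.
  have dfg z : differentiable (p \*: test_derivative k : R -> R) z.
    by apply/derivable1_diffP; have [] := dg z.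
  have dc := @differentiable_coord R 1 1 y 0 0.
  have E : (fun x : 'rV[R]_1 => p * test_derivative k (x 0 0)) =
    (p \*: test_derivative k : R -> R) \o (fun x : 'rV[R]_1 => x 0 0) by [].
  split; first by rewrite E; exact: differentiable_comp.
  rewrite E diff_comp//; apply/funext => v /=.
  rewrite diff1E// derive1E.
  rewrite derive_val /GRing.scale/=; congr (_ * _).
  by rewrite diff_coord.
elim: vs x => [|v vs IH] x.
  split; last by rewrite /= big_nil; apply/funext => y; rewrite mul1r.
  rewrite /= /test_function; apply: differentiableZl.
  have [+ _] := H 1 0%N x.
  by under eq_fun do rewrite mul1r.
have E : frechet test_function (v :: vs) =
  fun x : 'rV[R]_1 => ((\prod_(v <- v :: vs) v 0 0)
     * test_derivative (size (v :: vs)) (x 0 0)) *: const_mx 1.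
  apply/funext => y /=; have [_ ->] := IH y.
  have [h1 h2] := H (\prod_(v <- vs) v 0 0) (size vs) y.
  by rewrite diffZl// h2 big_cons mulrA.
split=> //; rewrite E; apply: differentiableZl.
by have [] := H (\prod_(v <- v :: vs) v 0 0) (size (v :: vs)) x.
Qed.

Lemma enorm1 (v : 'rV[R]_1) : enorm v = `|v 0 0|.
Proof. by rewrite /enorm big_ord1 sqrtr_sqr. Qed.

Lemma smooth_test_function U : smooth U test_function.
Proof. by move=> vs x _; have [] := frechet_test_functionE vs x. Qed.

Lemma enorm_frechet_test_function_le k B vs x :
  bounded_sums (fun j => c j * t j ^+ k) B -> size vs = k ->
  (forall v, v \in vs -> enorm v <= 1) ->
  enorm (frechet test_function vs x) <= 2 * B.
Proof.
move=> dB sk vs1; have [_ ->] := frechet_test_functionE vs x.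
rewrite enorm1 !mxE mulr1 normrM sk.
apply: le_trans (test_derivative_le (x 0 0) dB).
rewrite ler_piMl// normr_prod big_seq.
suff /andP[] : 0 <= \prod_(i <- vs | i \in vs) `|i 0 0| <= 1 by [].
apply: (big_ind (fun z => 0 <= z <= 1)); first by rewrite ler01 lexx.
  by move=> y z /andP[y0 y1] /andP[z0 z1]; rewrite mulr_ge0//= mulr_ile1.
by move=> v vvs; rewrite normr_ge0 -enorm1; exact: vs1.
Qed.

Lemma enorm_frechet_test_function_ge k j : exists2 vs : seq 'rV[R]_1,
  size vs = k /\ (forall v, v \in vs -> enorm v <= 1) &
  c j * t j ^+ k <= enorm (frechet test_function vs 0).
Proof.
exists (nseq k (const_mx 1)).
  split; first by rewrite size_nseq.
  by move=> v /nseqP[-> _]; rewrite enorm1 mxE normr1.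
have [_ ->] := frechet_test_functionE (nseq k (const_mx 1)) 0.
rewrite enorm1 !mxE mulr1 big1_seq; last by move=> v /= /nseqP[-> _]; rewrite mxE.
by rewrite mul1r size_nseq; exact: test_derivative0_ge.
Qed.

End TestFunctions.

(** * Inclusions between ultradifferentiable classes *)

Section ClassInclusions.
Context {R : realType}.

Definition seq_dom (w w' : R^nat) := exists2 C, 0 < C & forall k, w k <= C * w' k.

Lemma weighted_norm_lty r s (w : R^nat) (K : set 'rV[R]_r) (f : 'rV[R]_r -> 'rV[R]_s) :
  (forall k, 0 < w k) ->
  (weighted_norm w K f < +oo)%E <->
  exists C, forall k x vs, K x -> size vs = k ->
    (forall v, v \in vs -> enorm v <= 1) -> enorm (frechet f vs x) <= C * w k.
Proof.
move=> w0; split=> [fy|[C fC]]; last first.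
  apply: (@le_lt_trans _ _ C%:E); last exact: ltry.
  apply: ge_ereal_sup => _ [k _ [x Kx <-]].
  rewrite lee_pdivrMr// -EFinM.
  by apply: ge_ereal_sup => _ [vs [sk vs1] <-]; rewrite lee_fin fC.
exists (fine (weighted_norm w K f)) => k x vs Kx sk vs1.
have le : ((enorm (frechet f vs x) / w k)%:E <= weighted_norm w K f)%E.
  apply: (@le_trans _ _ (opnorm f k x * ((w k)^-1)%:E)%E).
    rewrite EFinM lee_wpmul2r ?lee_fin ?invr_ge0 ?(ltW (w0 k))//.
    by apply: ereal_sup_ubound; exists vs.
  by apply: ereal_sup_ubound; exists k => //; exists x.
rewrite -ler_pdivrMr// -lee_fin fineK//.
by rewrite fin_real// fy (lt_le_trans _ le)// ltNyr.
Qed.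

Definition E_fam (b : bracket) (W : R -> R^nat) : map_class := fun r s U =>
  [set f | smooth U f /\ forall K, compact K -> K `<=` U ->
     quant b (fun h => (weighted_norm (W h) K f < +oo)%E)].

Definition geometric_fam (M : R^nat) (h : R) : R^nat := fun k => h ^+ k * M k.

Lemma E_seqE b M : E_seq b M = E_fam b (geometric_fam M).
Proof. by []. Qed.

Lemma E_funE b (omega : R -> R) : E_fun b omega = E_fam b (Omega omega).
Proof. by []. Qed.

Definition fam_le (b : bracket) (W W' : R -> R^nat) :=
  match b with
  | Roumieu => forall h, 0 < h -> exists2 h', 0 < h' & seq_dom (W h) (W' h')
  | Beurling => forall h', 0 < h' -> exists2 h, 0 < h & seq_dom (W h) (W' h')
  end.

Definition fam_gt0 (W : R -> R^nat) := forall h k, 0 < h -> 0 < W h k.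

Definition class_sub (E F : map_class (R := R)) :=
  forall (r s : nat) (U : set 'rV[R]_r), open U -> U !=set0 -> E r s U `<=` F r s U.

Lemma class_eqP (E F : map_class (R := R)) :
  class_eq E F <-> class_sub E F /\ class_sub F E.
Proof.
split=> [EF|[EF FE] r s U oU U0].
  by split=> r s U oU U0; rewrite (EF r s U oU U0).
by apply/seteqP; split; [exact: EF | exact: FE].
Qed.

Lemma class_eq_trans (F E G : map_class (R := R)) :
  class_eq E F -> class_eq F G -> class_eq E G.
Proof. by move=> EF FG r s U oU U0; rewrite EF// FG. Qed.

Lemma class_eq_sym (E F : map_class (R := R)) : class_eq E F -> class_eq F E.
Proof. by move=> EF r s U oU U0; rewrite EF. Qed.

Lemma weighted_norm_dom r s w w' K (f : 'rV[R]_r -> 'rV[R]_s) :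
  (forall k, 0 < w k) -> (forall k, 0 < w' k) -> seq_dom w w' ->
  (weighted_norm w K f < +oo)%E -> (weighted_norm w' K f < +oo)%E.
Proof.
move=> w0 w'0 [D D0 wD] /(weighted_norm_lty _ _ w0)[C fC].
apply/(weighted_norm_lty _ _ w'0); exists (`|C| * D) => k x vs Kx sk vs1.
apply: (le_trans (fC k x vs Kx sk vs1)).
apply: (@le_trans _ _ (`|C| * w k)).
  by rewrite ler_wpM2r ?ler_norm// ltW.
by rewrite -mulrA ler_wpM2l.
Qed.

Lemma E_fam_sub b W W' : fam_gt0 W -> fam_gt0 W' -> fam_le b W W' ->
  class_sub (E_fam b W) (E_fam b W').
Proof.
move=> W0 W'0 WW' r s U oU _ f [sf fK]; split=> // K cK KU.
have := fK K cK KU; case: b WW' fK => /= WW' _.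
  move=> [h [h0 fh]]; have [h' h'0 d] := WW' h h0.
  by exists h'; split=> //; apply: weighted_norm_dom d fh => k; [exact: W0|exact: W'0].
move=> fh h' h'0; have [h h0 d] := WW' h' h'0.
by apply: weighted_norm_dom d (fh h h0) => k; [exact: W0|exact: W'0].
Qed.

Lemma E_fam_test b W W' (c t : R^nat) : fam_gt0 W -> fam_gt0 W' ->
  class_sub (E_fam b W) (E_fam b W') ->
  (forall j, 0 <= c j) -> (forall j, 0 <= t j) ->
  quant b (fun h => exists C, forall k,
    bounded_sums (fun j => c j * t j ^+ k) (C * W h k)) ->
  quant b (fun h => exists C, forall k j, c j * t j ^+ k <= C * W' h k).
Proof.
move=> W0 W'0 sub c0 t0 ctC.
have ct k : exists B, bounded_sums (fun j => c j * t j ^+ k) B.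
  case: b sub ctC => _ /=.
    by move=> [h [_ [C H]]]; exists (C * W h k).
  by move=> /(_ 1 ltr01)[C H]; exists (C * W 1 k).
have FW : (E_fam b W setT : set _) (test_function c t).
  split=> [|K _ _]; first exact: smooth_test_function.
  have H h : 0 < h -> (exists C, forall k,
      bounded_sums (fun j => c j * t j ^+ k) (C * W h k)) ->
      (weighted_norm (W h) K (test_function c t) < +oo)%E.
    move=> h0 [C CB]; apply/weighted_norm_lty => [k|]; first exact: W0.
    exists (2 * C) => k x vs _ sk vs1; rewrite -mulrA.
    exact: enorm_frechet_test_function_le.
  case: b {sub} ctC => /=.
    by move=> [h [h0 hC]]; exists h; split=> //; exact: H.
  by move=> hC h h0; exact: H (hC h h0).
have [_ /(_ [set (0 : 'rV_1)])] := sub 1%N 1%N setT openT (ex_intro _ 0 I) _ FW.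
have H h : 0 < h -> (weighted_norm (W' h) [set (0 : 'rV[R]_1)%R] (test_function c t) < +oo)%E ->
    exists C, forall k j, c j * t j ^+ k <= C * W' h k.
  move=> h0 /weighted_norm_lty[k|C CB]; first exact: W'0.
  exists C => k j.
  have [vs [sk vs1] /le_trans] := enorm_frechet_test_function_ge c0 t0 ct k j.
  by apply; exact: CB.
have cK : compact [set (0 : 'rV[R]_1)%R] by exact: compact_set1.
case: b {sub FW ctC} => /= /(_ cK (@subsetT _ _)).
  by move=> [h [h0 hC]]; exists h; split=> //; exact: H.
by move=> hC h h0; exact: H (hC h h0).
Qed.

End ClassInclusions.

Section WeightSequenceTests.
Context {R : realType}.
Implicit Types M N : R^nat.

Lemma quotients_gt0 M k : LC M -> 0 < quotients M k.
Proof. by move=> LM; rewrite divr_gt0// LC_gt0. Qed.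

Lemma quotientsS M k : LC M -> M k.+1 = M k * quotients M k.+1.
Proof. by move=> LM; rewrite /quotients/= mulrC divfK// gt_eqF// LC_gt0. Qed.

Lemma quotients_nondecreasing M : LC M -> nondecreasing_seq (quotients M).
Proof.
move=> LM; apply/nondecreasing_seqP => -[|k].
  have M0 := LC_gt0 LM 0%N.
  by rewrite /quotients/= divff ?gt_eqF// ler_pdivlMr// mul1r LC_01.
rewrite /quotients/= ler_pdivlMr ?LC_gt0// mulrAC ler_pdivrMr ?LC_gt0// mulrC -expr2.
by have := LC_logconvex LM (ltn0Sn k); rewrite [leRHS]mulrC; apply.
Qed.

Lemma LC_quotients_le M j k : LC M ->
  M j * quotients M j ^+ k <= M k * quotients M j ^+ j.
Proof.
move=> LM; have q0 i := quotients_gt0 i LM; have M0 i := LC_gt0 LM i.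
have nd := quotients_nondecreasing LM.
have up i : M j * quotients M j ^+ i <= M (j + i)%N.
  elim: i => [|i IH]; first by rewrite mulr1 addn0.
  rewrite addnS (quotientsS _ LM) exprSr mulrA ler_pM ?mulr_ge0 ?exprn_ge0 ?(ltW (M0 _)) ?(ltW (q0 _))//.
    by rewrite invr_ge0 ltW.
  by apply: nd; rewrite leqW// leq_addr.
have down i n : M (n + i)%N <= M n * quotients M (n + i)%N ^+ i.
  elim: i => [|i IH]; first by rewrite mulr1 addn0.
  rewrite addnS (quotientsS _ LM) exprSr mulrA ler_wpM2r ?(ltW (q0 _))//.
  apply: (le_trans IH); rewrite ler_wpM2l ?(ltW (M0 _))// lerXn2r ?nnegrE ?(ltW (q0 _))//.
  by apply: nd.
have [jk|/ltnW kj] := leqP j k.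
  have := up (k - j)%N; rewrite subnKC// => /(ler_wpM2r (exprn_ge0 j (ltW (q0 j)))).
  by rewrite -mulrA -exprD subnK.
have := down (j - k)%N k; rewrite subnKC// => /(ler_wpM2r (exprn_ge0 k (ltW (q0 j)))).
by rewrite -mulrA -exprD subnK.
Qed.

Lemma LC_expr_le M (t g : R) : LC M -> 0 <= t -> 0 < g ->
  exists2 D, 0 <= D & forall k, t ^+ k <= D * (g ^+ k * M k).
Proof.
move=> LM t0 g0; have M0 := LC_gt0 LM.
have /cvgryPge/(_ (t / g))[n _ nP] := LC_cvgy LM.
exists (1 + \sum_(i < n.+1) t ^+ i / (g ^+ i * M i)) => [|k].
  rewrite addr_ge0// sumr_ge0// => i _.
  by rewrite divr_ge0 ?exprn_ge0// mulr_ge0 ?exprn_ge0// ltW.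
have gM : 0 < g ^+ k * M k by rewrite mulr_gt0 ?exprn_gt0.
have S0 (P : pred 'I_n.+1) : 0 <= \sum_(i < n.+1 | P i) t ^+ i / (g ^+ i * M i).
  rewrite sumr_ge0// => i _.
  by rewrite divr_ge0 ?exprn_ge0// mulr_ge0 ?exprn_ge0// ltW.
rewrite -ler_pdivrMr//.
have [kn|nk] := ltnP k n.+1.
  by rewrite (bigD1 (Ordinal kn))//= addrCA lerDl addr_ge0.
rewrite ler_wpDr// ler_pdivrMr// mul1r.
have := nP k (ltnW nk); rewrite /= /nth_roots ler_pdivrMr// => tk.
have := lerXn2r k t0 _ tk; rewrite ?nnegrE => /(_ _)/le_trans; apply.
  by rewrite mulr_ge0 ?powR_ge0// ltW.
rewrite exprMn mulrC ler_wpM2l ?exprn_ge0 ?(ltW g0)//.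
rewrite -powR_mulrn ?powR_ge0// -powRrM mulVf ?powRr1 ?(ltW (M0 _))//.
by rewrite pnatr_eq0 -lt0n (leq_trans _ nk).
Qed.

Lemma sum_half_le n : \sum_(0 <= j < n) (2 ^- j : R) <= 2.
Proof.
suff -> : \sum_(0 <= j < n) (2 ^- j : R) = 2 - 2 * 2 ^- n.
  by rewrite gerBl mulr_ge0// invr_ge0 exprn_ge0.
elim: n => [|n IH]; first by rewrite big_nil expr0 invr1; lra.
rewrite big_nat_recr//= IH exprS invfM; lra.
Qed.

(* The function with coefficients [M j / (2 mu_j)^j] and frequencies [2 mu_j]
   is extremal in the Roumieu class. *)
Lemma E_Roumieu_sub_dom M (W : R -> R^nat) : LC M -> fam_gt0 W ->
  class_sub (E_seq Roumieu M) (E_fam Roumieu W) ->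
  exists2 h, 0 < h & seq_dom M (W h).
Proof.
move=> LM W0; rewrite E_seqE => sub.
have q0 i := quotients_gt0 i LM; have M0 := LC_gt0 LM.
have g0 : fam_gt0 (geometric_fam M).
  by move=> h k h0; rewrite mulr_gt0// exprn_gt0.
pose t j := 2 * quotients M j; pose c j := M j / t j ^+ j.
have t0 j : 0 < t j by rewrite mulr_gt0.
have c0 j : 0 < c j by rewrite divr_gt0// exprn_gt0.
have := @E_fam_test _ Roumieu _ _ c t g0 W0 sub
  (fun j => ltW (c0 j)) (fun j => ltW (t0 j)).
have ctE j : c j * t j ^+ j = M j by rewrite divfK// gt_eqF// exprn_gt0.
case=> [|h [h0 [C hC]]]; last first.
  exists h => //; exists (`|C| + 1) => [|k]; first by rewrite ltr_wpDl.
  rewrite -ctE; apply: (le_trans (hC k k)).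
  by rewrite ler_wpM2r ?(ltW (W0 _ _ h0))// ltW// ltr_pwDr// ler_norm.
exists 2; split => //; exists 2 => k n.
apply: (@le_trans _ _ (\sum_(0 <= j < n) 2 ^- j * geometric_fam M 2 k)); last first.
  by rewrite -mulr_suml ler_wpM2r ?sum_half_le// ltW// g0.
apply: ler_sum => j _.
rewrite /c mulrAC ler_pdivrMr ?exprn_gt0// /t (exprMn j 2) (exprMn k 2) /geometric_fam.
have -> : 2 ^- j * (2 ^+ k * M k) * (2 ^+ j * quotients M j ^+ j) =
  2 ^+ k * (M k * quotients M j ^+ j) * (2 ^- j * 2 ^+ j) by ring.
rewrite mulVf ?expf_neq0// mulr1 mulrCA ler_wpM2l ?exprn_ge0//.
exact: LC_quotients_le.
Qed.

(* Gliding hump: if the conclusion fails, choose [p j] violating it for [M j]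
   with [A = 2 ^ j (j + 1)]; the function with the frequencies
   [mu_(p j) / (j + 1)] lies in the smaller Beurling class only. *)
Lemma E_Beurling_sub_dom (M : nat -> R^nat) (W W' : R -> R^nat) :
  (forall j, LC (M j)) -> (forall i j k, (i <= j)%N -> M j k <= M i k) ->
  fam_gt0 W -> fam_gt0 W' ->
  (forall h, 0 < h -> exists j, exists2 g, 0 < g & seq_dom (geometric_fam (M j) g) (W h)) ->
  class_sub (E_fam Beurling W) (E_fam Beurling W') ->
  exists j, exists2 A, 0 < A & forall p, M j p <= A ^+ p.+1 * W' 1 p.
Proof.
move=> LM Mle W0 W'0 MW sub; apply: contrapT => neg.
have M0 j k : 0 < M j k := LC_gt0 (LM j) k.
have : forall j, exists p, (2 ^+ j * j.+1%:R) ^+ p.+1 * W' 1 p < M j p.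
  move=> j; apply: contrapT => nj; apply: neg; exists j.
  exists (2 ^+ j * j.+1%:R); first by rewrite mulr_gt0 ?exprn_gt0.
  by move=> p; rewrite leNgt; apply/negP => lt; apply: nj; exists p.
move=> /choice[p pP].
pose mu j := quotients (M j) (p j).
have mu0 j : 0 < mu j := quotients_gt0 _ (LM j).
pose t j := mu j / j.+1%:R; pose c j := 2 ^- j * M j (p j) / mu j ^+ p j.
have t0 j : 0 < t j by rewrite divr_gt0.
have c0 j : 0 < c j.
  by rewrite divr_gt0 ?exprn_gt0// mulr_gt0// invr_gt0 exprn_gt0.
have ct j k : c j * t j ^+ k <= 2 ^- j * (j.+1%:R ^- k * M j k).
  rewrite /c mulrAC ler_pdivrMr ?exprn_gt0// /t expr_div_n.
  have -> : 2 ^- j * M j (p j) * (mu j ^+ k / j.+1%:R ^+ k) =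
    2 ^- j / j.+1%:R ^+ k * (M j (p j) * mu j ^+ k) by ring.
  have -> : 2 ^- j * (j.+1%:R ^- k * M j k) * mu j ^+ p j =
    2 ^- j / j.+1%:R ^+ k * (M j k * mu j ^+ p j) by ring.
  rewrite ler_wpM2l ?divr_ge0 ?invr_ge0 ?exprn_ge0//.
  exact: LC_quotients_le.
have T := @E_fam_test _ Beurling W W' c t W0 W'0 sub
  (fun j => ltW (c0 j)) (fun j => ltW (t0 j)).
suff ctW : forall h, 0 < h -> exists C, forall k,
    bounded_sums (fun j => c j * t j ^+ k) (C * W h k).
  have [C hC] := T ctW 1 ltr01.
  have [n nC] : exists n, C < n.+1%:R.
    exists (Num.truncn C); exact: truncnS_gt.
  have := hC (p n) n; apply/negP; rewrite -ltNge.
  have W'p : 0 < W' 1 (p n) by exact: W'0.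
  apply: (@lt_le_trans _ _ (n.+1%:R * W' 1 (p n))); first by rewrite ltr_pM2r.
  rewrite /c /t (expr_div_n (mu n)).
  have -> : 2 ^- n * M n (p n) / mu n ^+ p n * (mu n ^+ p n / n.+1%:R ^+ p n) =
    2 ^- n / n.+1%:R ^+ p n * M n (p n).
    have /gt_eqF/negbT mp : 0 < mu n ^+ p n by rewrite exprn_gt0.
    have /gt_eqF/negbT np : (0 : R) < n.+1%:R ^+ p n by rewrite exprn_gt0.
    have /gt_eqF/negbT n2 : (0 : R) < 2 ^+ n by rewrite exprn_gt0.
    by field; rewrite mp np n2.
  have q0 : 0 <= 2 ^- n / n.+1%:R ^+ p n :> R by rewrite divr_ge0 ?invr_ge0 ?exprn_ge0.
  apply: le_trans (ler_wpM2l q0 (ltW (pP n))).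
  rewrite mulrA ler_wpM2r ?(ltW W'p)// exprMn !exprS.
  have -> : 2 ^- n / n.+1%:R ^+ p n * (2 ^+ n * (2 ^+ n) ^+ p n *
     (n.+1%:R * n.+1%:R ^+ p n)) = n.+1%:R * (2 ^+ n) ^+ p n :> R.
    have /gt_eqF/negbT np : (0 : R) < n.+1%:R ^+ p n by rewrite exprn_gt0.
    have /gt_eqF/negbT n2 : (0 : R) < 2 ^+ n by rewrite exprn_gt0.
    by field; rewrite np n2.
  by rewrite ler_pMr// exprn_ege1// exprn_ege1// ler1n.
move=> h h0; have [J [g g0 [C C0 gC]]] := MW h h0.
have G0 k : 0 < geometric_fam (M J) g k by rewrite mulr_gt0// exprn_gt0.
have /choice[D DP] : forall j, exists D, 0 <= D /\ forall k, c j * t j ^+ k <= D * geometric_fam (M J) g k.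
  move=> j; have [D D0 DP] := LC_expr_le (LM J) (ltW (t0 j)) g0.
  exists (c j * D); split=> [|k]; first by rewrite mulr_ge0// ltW.
  by rewrite -[leRHS]mulrA (ler_wpM2l (ltW (c0 j)))// DP.
pose n0 := maxn J (Num.truncn g^-1).
pose S := \sum_(0 <= j < n0) D j.
have S0 : 0 <= S by apply: sumr_ge0 => j _; have [] := DP j.
have dS n : \sum_(0 <= j < n) ((if (j < n0)%N then D j else 0) + 2 ^- j) <= S + 2.
  rewrite big_split/= lerD ?sum_half_le//.
  rewrite -big_mkcond/=.
  apply: (@le_trans _ _ (\sum_(0 <= j < maxn n n0 | (j < n0)%N) D j)).
    rewrite (@big_cat_nat _ _ _ n _ (maxn n n0))//= ?leq_maxl// lerDl sumr_ge0//.
    by move=> j _; have [] := DP j.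
  rewrite (@big_cat_nat _ _ _ n0 _ (maxn n n0))//= ?leq_maxr//.
  rewrite [X in _ + X]big1_seq ?addr0.
    rewrite /S big_nat_cond [leRHS]big_nat_cond le_eqVlt; apply/orP; left; apply/eqP.
    by apply: eq_bigl => j; rewrite andbT; case: (j < n0)%N; rewrite ?andbF ?andbT.
  move=> j /andP[jn]; rewrite mem_index_iota => /andP[nj _].
  by rewrite ltnNge nj in jn.
exists ((S + 2) * C) => k n.
apply: (@le_trans _ _ ((S + 2) * geometric_fam (M J) g k)); last first.
  by rewrite -mulrA ler_wpM2l// addr_ge0.
apply: le_trans (ler_wpM2r (ltW (G0 k)) (dS n)).
rewrite mulr_suml; apply: ler_sum => j _; rewrite mulrDl.
have [jn|nj] := ltnP j n0.
  apply: (@le_trans _ _ (D j * geometric_fam (M J) g k)); first exact: (DP j).2.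
  by rewrite lerDl mulr_ge0 ?invr_ge0 ?exprn_ge0// ltW.
rewrite mul0r add0r; apply: (le_trans (ct j k)).
rewrite ler_wpM2l ?invr_ge0 ?exprn_ge0// ler_pM ?invr_ge0 ?exprn_ge0 ?(ltW (M0 _ _))//.
  rewrite -exprVn lerXn2r ?nnegrE ?invr_ge0 ?(ltW g0)//.
  rewrite -[g]invrK ler_pV2 ?inE ?unitf_gt0 ?invr_gt0//= ?ltr0n//.
  apply: ltW; apply: lt_le_trans (truncnS_gt _) _.
  by rewrite ler_nat ltnS (leq_trans _ nj)// leq_maxr.
by apply: Mle; rewrite (leq_trans _ nj)// leq_maxl.
Qed.

End WeightSequenceTests.

(** * Logarithmic comparison of sequences and Young conjugates *)

Section LogarithmicDomination.
Context {R : realType}.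
Implicit Types M N : R^nat.

Definition log_dom M N :=
  exists2 a, 0 <= a & forall p, ln (M p) <= ln (N p) + a * p.+1%:R.

Lemma log_dom_refl M : log_dom M M.
Proof. by exists 0 => // p; rewrite mul0r addr0. Qed.

Lemma log_dom_trans N M P : log_dom M N -> log_dom N P -> log_dom M P.
Proof.
move=> [a a0 MN] [c c0 NP]; exists (a + c) => [|p]; first exact: addr_ge0.
by have := MN p; have := NP p; rewrite mulrDl; lra.
Qed.

Lemma log_dom_seq_dom M N : (forall p, 0 < M p) -> (forall p, 0 < N p) ->
  log_dom M N -> exists2 a, 0 < a &
  forall g, 0 < g -> seq_dom (geometric_fam M g) (geometric_fam N (g * a)).
Proof.
move=> M0 N0 [a a0 MN]; exists (expR a) => [|g g0]; first exact: expR_gt0.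
exists (expR a) => [|k]; first exact: expR_gt0.
rewrite /geometric_fam exprMn -expRM_natr.
rewrite -[M k]lnK ?posrE// -[N k]lnK ?posrE//.
have -> : expR a * (g ^+ k * expR (a * k%:R) * expR (ln (N k))) =
  g ^+ k * expR (ln (N k) + a * k.+1%:R).
  by rewrite -addn1 natrD mulrDr mulr1 !expRD; ring.
by rewrite ler_wpM2l ?exprn_ge0 ?(ltW g0)// ler_expR.
Qed.

Lemma seq_dom_log_dom M N A C : (forall p, 0 < M p) -> (forall p, 0 < N p) ->
  0 < A -> 0 < C -> (forall p, M p <= C * A ^+ p * N p) -> log_dom M N.
Proof.
move=> M0 N0 A0 C0 MN; exists (`|ln C| + `|ln A|) => [|p]; first exact: addr_ge0.
have := MN p; rewrite -ler_ln ?posrE// ?mulr_gt0 ?exprn_gt0//.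
rewrite !lnM ?posrE ?mulr_gt0 ?exprn_gt0// lnXn// => /le_trans; apply.
rewrite addrC lerD2l -(mulr_natl (ln A)) -natr1.
have := ler_norm (ln C); have := ler_norm (ln A).
have := normr_ge0 (ln C); have := normr_ge0 (ln A).
have : (0 : R) <= p%:R by [].
by nra.
Qed.

Lemma log_dom_fam_le b M N : (forall p, 0 < M p) -> (forall p, 0 < N p) ->
  log_dom M N -> fam_le b (geometric_fam M) (geometric_fam N).
Proof.
move=> M0 N0 MN; have [a a0 aP] := log_dom_seq_dom M0 N0 MN.
case: b => /= h h0; first by exists (h * a); [rewrite mulr_gt0|exact: aP].
exists (h / a); first by rewrite divr_gt0.
by have := aP (h / a); rewrite divfK ?gt_eqF//; apply; rewrite divr_gt0.
Qed.

Lemma geometric_fam_gt0 M : (forall p, 0 < M p) -> fam_gt0 (geometric_fam M).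
Proof. by move=> M0 h k h0; rewrite mulr_gt0 ?exprn_gt0. Qed.

Lemma log_dom_class_sub b M N : (forall p, 0 < M p) -> (forall p, 0 < N p) ->
  log_dom M N -> class_sub (E_seq b M) (E_seq b N).
Proof.
move=> M0 N0 MN; rewrite !E_seqE.
by apply: E_fam_sub; [exact: geometric_fam_gt0..|exact: log_dom_fam_le].
Qed.

Lemma nth_rootsE M p : 0 < M p -> nth_roots M p = expR (p%:R^-1 * ln (M p)).
Proof. by move=> Mp; rewrite /nth_roots /powR gt_eqF. Qed.

Lemma preceqP M N : (forall p, 0 < M p) -> (forall p, 0 < N p) ->
  preceq M N <-> log_dom M N.
Proof.
move=> M0 N0; rewrite /preceq.
have MN0 p : 0 < M p / N p by rewrite divr_gt0.
have lnMN p : ln (M p / N p) = ln (M p) - ln (N p) by rewrite ln_div ?posrE.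
split=> [Sy|[a a0 MN]]; last first.
  apply: (@le_lt_trans _ _ (expR (2 * a))%:E); last exact: ltry.
  apply: ge_ereal_sup => _ [p /= p1 <-].
  rewrite lee_fin nth_rootsE// ler_expR lnMN.
  have p0 : (0 : R) < p%:R by rewrite ltr0n.
  rewrite mulrC ler_pdivrMr//.
  have := MN p; have : (1 : R) <= p%:R by rewrite ler1n.
  by rewrite -natr1; nra.
set S := ereal_sup _ in Sy.
have le p : (1 <= p)%N -> ((nth_roots (fun k => M k / N k) p)%:E <= S)%E.
  by move=> p1; apply: ereal_sup_ubound; exists p.
have Sfin : S \is a fin_num.
  by rewrite fin_real// Sy (lt_le_trans _ (le 1%N _))// ltNyr.
exists (`|fine S| + `|ln (M 0%N) - ln (N 0%N)|) => [|p]; first exact: addr_ge0.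
case: p => [|p].
  rewrite mulr1; have := ler_norm (ln (M 0%N) - ln (N 0%N)).
  by have := normr_ge0 (fine S); lra.
have := le p.+1 isT; rewrite nth_rootsE// lnMN -(fineK Sfin) lee_fin => eS.
have := le_trans (expR_ge1Dx _) eS.
set u := ln (M _) - _; set v := _ * u; move=> vS.
have uv : u = v * p.+1%:R by rewrite /v mulrAC mulVf ?mul1r// pnatr_eq0.
have := ler_norm (fine S); have := normr_ge0 (fine S).
have := normr_ge0 (ln (M 0%N) - ln (N 0%N)).
move: uv vS; rewrite /u -(natr1 p.+1).
have : (0 : R) <= p.+1%:R by [].
set d := `|_|; set e := `|_|; set q := p.+1%:R => q0 uv vS d0 e0 Se.
have : v * q <= e * q by rewrite ler_wpM2r//; lra.
by nra.
Qed.

Lemma class_sub_log_dom b (M N : R^nat) : LC M -> (forall p, 0 < N p) ->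
  class_sub (E_seq b M) (E_seq b N) -> log_dom M N.
Proof.
move=> LM N0; have M0 := LC_gt0 LM.
case: b => sub.
  have [h h0 [C C0 CP]] := E_Roumieu_sub_dom LM (geometric_fam_gt0 N0) sub.
  by apply: (seq_dom_log_dom (A := h) (C := C)) => // p; rewrite -mulrA; exact: CP.
have MW h : 0 < h -> exists j : nat, exists2 g, 0 < g &
    seq_dom (geometric_fam M g) (geometric_fam M h).
  by move=> h0; exists 0%N, h => //; exists 1 => // k; rewrite mul1r.
have [_ [A A0 AP]] := @E_Beurling_sub_dom _ (fun _ => M) _ _ (fun _ => LM)
  (fun _ _ _ _ => lexx _) (geometric_fam_gt0 M0) (geometric_fam_gt0 N0) MW sub.
apply: (seq_dom_log_dom (A := A) (C := A)) => // p; rewrite -exprS.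
by have := AP p; rewrite /geometric_fam expr1n mul1r.
Qed.

Lemma class_eq_log_dom b (M N : R^nat) : LC M -> LC N ->
  class_eq (E_seq b M) (E_seq b N) <-> log_dom M N /\ log_dom N M.
Proof.
move=> LM LN; have M0 := LC_gt0 LM; have N0 := LC_gt0 LN.
split=> [/class_eqP[MN NM]|[MN NM]].
  by split; [exact: class_sub_log_dom MN|exact: class_sub_log_dom NM].
by apply/class_eqP; split; exact: log_dom_class_sub.
Qed.

End LogarithmicDomination.

Section YoungConjugate.
Context {R : realType}.
Implicit Types (omega sigma tau : R -> R).

Definition coercive omega :=
  forall x : R, exists B, forall y, 0 <= y -> x * y - phi omega y <= B.

Lemma phistar_ub omega x y : coercive omega -> 0 <= y ->
  x * y - phi omega y <= phistar omega x.
Proof.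
move=> /(_ x)[B xB] y0; apply: sup_upper_bound; last by exists y.
split; first by exists (x * 0 - phi omega 0); exists 0 => /=.
by exists B => _ [z z0 <-]; exact: xB.
Qed.

Lemma phistar_le omega x B : (forall y, 0 <= y -> x * y - phi omega y <= B) ->
  phistar omega x <= B.
Proof.
move=> xB; apply: ge_sup; first by exists (x * 0 - phi omega 0); exists 0 => /=.
by move=> _ [y y0 <-]; exact: xB.
Qed.

Lemma Omega_gt0 omega : fam_gt0 (Omega omega).
Proof. by move=> l k _; exact: expR_gt0. Qed.

Lemma ln_Omega omega l k : ln (Omega omega l k) = l^-1 * phistar omega (l * k%:R).
Proof. by rewrite expRK. Qed.

Lemma Omega_fam_le b sigma tau C : coercive tau -> 0 < C ->
  (forall y, 0 <= y -> phi tau y <= C * phi sigma y + C) ->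
  fam_le b (Omega sigma) (Omega tau).
Proof.
move=> ct C0 ts.
have H h h' : 0 < h -> 0 < h' -> h * C = h' -> seq_dom (Omega sigma h) (Omega tau h').
  move=> h0 h'0 hh'; exists (expR (C / h')) => [|k]; first exact: expR_gt0.
  rewrite /Omega -expRD ler_expR -hh'.
  suff H : C * phistar sigma (h * k%:R) <= phistar tau (h * C * k%:R) + C.
    have hC : 0 <= (h * C)^-1 by rewrite invr_ge0 mulr_ge0 ?ltW.
    have := ler_wpM2l hC H; rewrite !invfM.
    have -> : h^-1 / C * (C * phistar sigma (h * k%:R)) = h^-1 * phistar sigma (h * k%:R).
      by field; rewrite !gt_eqF.
    by rewrite mulrDr addrC (mulrC C).
  rewrite mulrC -ler_pdivlMr//; apply: phistar_le => y y0.
  rewrite ler_pdivlMr//.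
  have := phistar_ub (h * C * k%:R) ct y0; have := ts y y0.
  by lra.
case: b => /= h h0; [exists (h * C)|exists (h / C)]; rewrite ?divr_gt0 ?mulr_gt0//.
  by apply: H; rewrite ?mulr_gt0.
by apply: H; rewrite ?divr_gt0// divfK// gt_eqF.
Qed.

Variable omega : R -> R.
Hypothesis omegaW : weight_function omega.
Local Notation phi := (phi omega).
Local Notation phistar := (phistar omega).
Local Notation Omega := (Omega omega).

Lemma phi_ge0 y : 0 <= phi y.
Proof. by apply: (weight_ge0 omegaW); exact: expR_ge0. Qed.

Lemma weight_le (s t : R) : 0 <= s -> s <= t -> omega s <= omega t.
Proof.
move=> s0 st; apply: (weight_nondecreasing omegaW) => //; rewrite in_itv/= andbT//.
exact: le_trans st.
Qed.

Lemma phi_le (y z : R) : y <= z -> phi y <= phi z.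
Proof. by move=> yz; apply: weight_le; rewrite ?expR_ge0// ler_expR. Qed.

Lemma phi_eq0 y : y <= 0 -> phi y = 0.
Proof. by move=> y0; apply: (weight_eq0 omegaW); rewrite expR_ge0 -expR0 ler_expR. Qed.

Lemma phi_convex (x y t : R) : 0 <= t -> t <= 1 ->
  phi (t * x + (1 - t) * y) <= t * phi x + (1 - t) * phi y.
Proof.
move=> t0 t1.
have := weight_convex omegaW (Itv01 t0 t1) (x := x) (y := y).
by rewrite !in_setT => /(_ isT isT).
Qed.

Lemma phi_slope (x y z : R) : x < y -> y < z ->
  (phi y - phi x) * (z - y) <= (phi z - phi y) * (y - x).
Proof.
move=> xy yz; have zx : 0 < z - x by lra.
pose t := (z - y) / (z - x).
have tzx : t * (z - x) = z - y by rewrite divfK// gt_eqF.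
have t0 : 0 <= t by rewrite divr_ge0; lra.
have t1 : t <= 1 by rewrite ler_pdivrMr//; lra.
have := phi_convex x z t0 t1.
have -> : t * x + (1 - t) * z = y by have : t * (z - x) = z - y := tzx; lra.
move=> /(ler_wpM2r (ltW zx)).
have -> : (t * phi x + (1 - t) * phi z) * (z - x) =
  (z - y) * phi x + (y - x) * phi z by rewrite mulrDl mulrAC tzx; have := tzx; nra.
by lra.
Qed.

Lemma phi_subgradient y : exists2 x, 0 <= x & forall z, phi y + x * (z - y) <= phi z.
Proof.
pose S := [set (phi y - phi z) / (y - z) | z in [set z | z < y]].
have ub z : y < z -> ubound S ((phi z - phi y) / (z - y)).
  move=> yz _ [x /= xy <-].
  rewrite ler_pdivrMr ?subr_gt0// mulrAC ler_pdivlMr ?subr_gt0//.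
  exact: phi_slope.
have S0 : S !=set0 by exists ((phi y - phi (y - 1)) / (y - (y - 1))), (y - 1) => //=; lra.
have hS : has_sup S by split=> //; exists ((phi (y + 1) - phi y) / (y + 1 - y)); apply: ub; lra.
exists (sup S) => [|z].
  have [_ [x /= xy _]] := S0; apply: (@le_trans _ _ ((phi y - phi x) / (y - x))).
    by rewrite divr_ge0// subr_ge0 ?phi_le// ltW.
  by apply: sup_upper_bound => //; exists x.
have [zy|yz|->] := ltgtP z y; last by rewrite subrr mulr0 addr0.
  have : (phi y - phi z) / (y - z) <= sup S by apply: sup_upper_bound => //; exists z.
  rewrite ler_pdivrMr ?subr_gt0//; lra.
have : sup S <= (phi z - phi y) / (z - y) by apply: ge_sup => //; exact: ub.
rewrite ler_pdivlMr ?subr_gt0//; lra.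
Qed.

Lemma weight_ln_le (eps : R) : 0 < eps ->
  exists2 C, 0 <= C & forall y, 0 <= y -> y <= eps * phi y + C.
Proof.
move=> eps0; have [A [_ AP]] := weight_ln omegaW eps0.
exists `|A| => // y y0.
have [yA|Ay] := leP (expR y) A.
  have := expR_ge1Dx y; have := ler_norm A; have := phi_ge0 y; nra.
have := AP _ Ay; rewrite expRK (ger0_norm y0) (ger0_norm (phi_ge0 y)).
have := normr_ge0 A; rewrite /Defs.phi; lra.
Qed.

Lemma weight_coercive : coercive omega.
Proof.
move=> x; have x0 : 0 < `|x| + 1 by rewrite ltr_wpDl.
have [C C0 CP] := @weight_ln_le (`|x| + 1)^-1 ltac:(by rewrite invr_gt0).
exists ((`|x| + 1) * C) => y y0.
have := ler_wpM2l (ltW x0) (CP y y0); rewrite mulrDr mulrA divff ?gt_eqF// mul1r.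
by have := ler_norm x; nra.
Qed.

Lemma phistar_ge x y : 0 <= y -> x * y - phi y <= phistar x.
Proof. exact: (phistar_ub _ weight_coercive). Qed.

Lemma phistar_ge0 x : 0 <= phistar x.
Proof. by have := @phistar_ge x 0 (lexx _); rewrite phi_eq0// mulr0 subr0. Qed.

Lemma phistar0 : phistar 0 = 0.
Proof.
apply/eqP; rewrite eq_le phistar_ge0 andbT.
by apply: phistar_le => y y0; rewrite mul0r sub0r oppr_le0 phi_ge0.
Qed.

Lemma phistar_convex (x z t : R) : 0 <= t -> t <= 1 ->
  phistar (t * x + (1 - t) * z) <= t * phistar x + (1 - t) * phistar z.
Proof.
move=> t0 t1; apply: phistar_le => y y0.
have t1' : 0 <= 1 - t by lra.
have := ler_wpM2l t0 (phistar_ge x y0); have := ler_wpM2l t1' (phistar_ge z y0).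
lra.
Qed.

Lemma phistar_scale (x t : R) : 0 <= t -> t <= 1 -> phistar (t * x) <= t * phistar x.
Proof.
by move=> t0 t1; have := phistar_convex x 0 t0 t1; rewrite phistar0 !mulr0 !addr0.
Qed.

Lemma phi_young y : 0 <= y -> exists2 x, 0 <= x & phi y <= x * y - phistar x.
Proof.
move=> y0; have [x x0 xP] := phi_subgradient y; exists x => //.
suff : phistar x <= x * y - phi y by lra.
by apply: phistar_le => z z0; have := xP z; lra.
Qed.

Lemma Omega_le (l l' : R) k : 0 < l -> l <= l' -> Omega l k <= Omega l' k.
Proof.
move=> l0 ll'; have l'0 : 0 < l' by lra.
rewrite ler_expR.
have := @phistar_scale (l' * k%:R) (l / l').
rewrite divr_ge0 ?(ltW l0) ?(ltW l'0)// ler_pdivrMr// mul1r => /(_ isT ll').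
rewrite mulrA divfK ?gt_eqF// => H.
have := ler_wpM2l (ltW (_ : 0 < l^-1)) H; rewrite invr_gt0 => /(_ l0)/le_trans; apply.
by rewrite !mulrA mulVf ?mul1r// gt_eqF.
Qed.

Lemma Omega_LC (l : R) : 0 < l -> LC (Omega l).
Proof.
move=> l0; have li : 0 < l^-1 by rewrite invr_gt0.
split.
- by move=> k; exact: expR_gt0.
- by rewrite /Defs.Omega mulr0 phistar0 mulr0 expR0.
- by rewrite ler_expR mulr0 phistar0 mulr0 mulr_ge0 ?phistar_ge0// ltW.
- case=> // j _; rewrite -expRM_natl -expRD ler_expR/= -mulrDr mulrCA ler_wpM2l ?(ltW li)//.
  have := @phistar_convex (l * j%:R) (l * j.+2%:R) 2^-1.
  have -> : 2^-1 * (l * j%:R) + (1 - 2^-1) * (l * j.+2%:R) = l * j.+1%:R.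
    by rewrite -(natr1 j.+1) -(natr1 j); field.
  have h0 : 0 <= 2^-1 :> R by lra.
  have h1 : 2^-1 <= 1 :> R by lra.
  by move=> /(_ h0 h1); lra.
apply/cvgryPge => A; near=> p.
have p0 : (0 : R) < p%:R by near: p; exact: nbhs_infty_gtr.
rewrite nth_rootsE ?expR_gt0// ln_Omega.
apply: (le_trans _ (expR_ge1Dx _)).
have pl : phi `|A| / l <= p%:R by near: p; exact: nbhs_infty_ger.
have := @phistar_ge (l * p%:R) `|A| (normr_ge0 _).
have plp : phi `|A| <= l * p%:R by rewrite mulrC -ler_pdivrMr.
move=> H; have : l * p%:R * (`|A| - 1) <= phistar (l * p%:R) by lra.
have lp : 0 < l * p%:R by rewrite mulr_gt0.
rewrite mulrC -ler_pdivlMr// mulrA -invfM mulrC (mulrC p%:R).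
by have := ler_norm A; lra.
Unshelve. all: by end_near. Qed.

End YoungConjugate.

(** * The weight matrix of a weight function *)

Section WeightMatrix.
Context {R : realType}.
Variable omega : R -> R.
Hypothesis omegaW : weight_function omega.
Local Notation phi := (phi omega).
Local Notation phistar := (phistar omega).
Local Notation Omega := (Omega omega).

Lemma phi_double : exists2 C, 1 <= C & forall y, phi (y + ln 2) <= C * phi y + C.
Proof.
have [C [A [_ CA]]] := weight_omega1 omegaW.
have w0 : 0 <= omega (2 * `|A|) by apply: (weight_ge0 omegaW); rewrite mulr_ge0.
have C0 := normr_ge0 C.
exists (`|C| + 1 + omega (2 * `|A|)) => [|y]; first by lra.
have E : phi (y + ln 2) = omega (2 * expR y).
  by rewrite /Defs.phi expRD lnK ?posrE// mulrC.
have p0 := phi_ge0 omegaW y; have ey := expR_ge0 y.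
rewrite E; have [yA|Ay] := leP (expR y) A.
  have : omega (2 * expR y) <= omega (2 * `|A|).
    apply: (weight_le omegaW); first by rewrite mulr_ge0.
    by rewrite ler_wpM2l// (le_trans yA)// ler_norm.
  by nra.
have := CA _ Ay.
rewrite ger0_norm ?(weight_ge0 omegaW) ?mulr_ge0// (ger0_norm p0) -/(phi y) => h.
apply: (le_trans h).
have := ler_norm C; nra.
Qed.

Lemma phi_shift (a : R) :
  exists2 C, 1 <= C & forall y, phi (y + a) <= C * phi y + C.
Proof.
have [D D1 DP] := phi_double.
have H n : exists2 C, 1 <= C & forall y, phi (y + n%:R * ln 2) <= C * phi y + C.
  elim: n => [|n [C C1 IH]].
    by exists 1 => // y; rewrite mul0r addr0 mul1r lerDl.
  exists (D * C + D) => [|y]; first by nra.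
  have := DP (y + n%:R * ln 2); rewrite -addrA -{2}(mul1r (ln 2)) -mulrDl natr1.
  move=> /le_trans; apply.
  have := IH y; have := phi_ge0 omegaW y; nra.
have l2 : (0 : R) < ln 2 by rewrite ln_gt0// ltr1n.
have [C C1 CP] := H (Num.truncn (a / ln 2)).+1.
exists C => // y; apply: le_trans (CP y).
by apply: phi_le => //; rewrite lerD2l -ler_pdivrMr// ltW// truncnS_gt.
Qed.

Lemma phistar_dilate (a : R) : 0 <= a -> exists2 C, 1 <= C & forall D x, C <= D ->
  D * phistar x + D * a * x - D <= phistar (D * x).
Proof.
move=> a0; have [C C1 CP] := phi_shift a.
exists C => // D x CD; have D0 : 0 < D by lra.
suff : phistar x <= (phistar (D * x) + D - D * a * x) / D.
  by rewrite ler_pdivlMr//; lra.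
apply: phistar_le => y y0; rewrite ler_pdivlMr//.
have ya : 0 <= y + a by exact: addr_ge0.
have := phistar_ge omegaW (D * x) ya; have := CP y.
have : C * phi y <= D * phi y by rewrite ler_wpM2r// phi_ge0.
by lra.
Qed.

Lemma phistar_mono (x z : R) : x <= z -> phistar x <= phistar z.
Proof.
move=> xz; apply: phistar_le => y y0; have := phistar_ge omegaW z y0; nra.
Qed.

Lemma Omega_absorb (h : R) : 0 < h -> exists2 L, 1 <= L &
  forall l, 0 < l -> seq_dom (geometric_fam (Omega l) h) (Omega (L * l)).
Proof.
move=> h0; have [L L1 LP] := phistar_dilate (normr_ge0 (ln h)).
have L0 : 0 < L by lra.
exists L => // l l0; exists (expR l^-1) => [|k]; first exact: expR_gt0.
rewrite /geometric_fam -[h]lnK ?posrE// -expRM_natr -!expRD ler_expR.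
have Ll : 0 < L * l by rewrite mulr_gt0.
have -> : l^-1 + (L * l)^-1 * phistar (L * l * k%:R) =
  (L + phistar (L * (l * k%:R))) / (L * l).
  by rewrite mulrA; field; rewrite !gt_eqF.
rewrite ler_pdivlMr//.
have -> : (ln h * k%:R + l^-1 * phistar (l * k%:R)) * (L * l) =
  L * phistar (l * k%:R) + L * (ln h) * (l * k%:R) by field; rewrite gt_eqF.
have := LP L (l * k%:R) (lexx _); have : L * ln h * (l * k%:R) <= L * `|ln h| * (l * k%:R).
  by rewrite ler_wpM2r ?mulr_ge0 ?(ltW l0)// ler_wpM2l ?(ltW L0)// ler_norm.
by lra.
Qed.

Lemma Omega_absorbed (h l : R) : 0 < h -> 0 < l ->
  exists2 m, 0 < m & seq_dom (Omega m) (geometric_fam (Omega l) h).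
Proof.
move=> h0 l0; have hi : 0 < h^-1 by rewrite invr_gt0.
have [L L1 LP] := Omega_absorb hi; have L0 : 0 < L by lra.
have lL : 0 < l / L by rewrite divr_gt0.
exists (l / L) => //; have [C C0 CP] := LP _ lL.
exists C => // k; have := CP k; rewrite mulrCA divff ?gt_eqF// mulr1 /geometric_fam.
by rewrite exprVn mulrC ler_pdivrMr ?exprn_gt0// -mulrA (mulrC (h ^+ k)).
Qed.

Lemma E_fun_mat b : class_eq (E_fun b omega) (E_mat b Omega).
Proof.
have pos l k : 0 < Omega l k := expR_gt0 _.
have gpos l h k : 0 < h -> 0 < geometric_fam (Omega l) h k.
  by move=> h0; exact: geometric_fam_gt0.
have dom1 l : seq_dom (Omega l) (geometric_fam (Omega l) 1).
  by exists 1 => // k; rewrite /geometric_fam expr1n !mul1r.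
apply/class_eqP; split=> r s U oU _ f [sf fK]; split=> // K cK KU; move: (fK K cK KU).
  case: b fK => /= _.
    move=> [l [l0 fl]]; exists l; split=> //; exists 1; split=> //.
    exact: (weighted_norm_dom (pos l) (fun k => gpos l _ k ltr01) (dom1 l) fl).
  move=> fl l l0 h h0; have [m m0 mP] := Omega_absorbed h0 l0.
  exact: (weighted_norm_dom (pos _) (fun k => gpos l _ k h0) mP (fl _ m0)).
case: b fK => /= _.
  move=> [l [l0 [h [h0 fl]]]]; have [L L1 LP] := Omega_absorb h0.
  exists (L * l); split; first by rewrite mulr_gt0//; lra.
  exact: (weighted_norm_dom (fun k => gpos l _ k h0) (pos _) (LP l l0) fl).
move=> fl l l0.
apply: (weighted_norm_dom (fun k => gpos l _ k ltr01) (pos _) _ (fl l l0 1 ltr01)).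
by exists 1 => // k; rewrite /geometric_fam expr1n !mul1r.
Qed.

Lemma omega6_log_dom2 (l : R) : omega6 omega -> 0 < l -> log_dom (Omega (2 * l)) (Omega l).
Proof.
move=> [H [H1 HP]] l0; have H0 : 0 < H by lra.
have lH : 0 <= ln H by rewrite ln_ge0.
have dbl x : 0 <= x -> phistar (2 * x) <= 2 * phistar x + 2 * x * ln H + H.
  move=> x0; have px := phistar_ge0 omegaW x.
  apply: phistar_le => z z0; have pz := phi_ge0 omegaW z.
  have [zH|Hz] := leP z (ln H); first by nra.
  have y0 : 0 <= z - ln H by lra.
  have := HP _ (expR_ge0 (z - ln H)).
  have -> : H * expR (z - ln H) = expR z.
    by rewrite -{1}[H]lnK ?posrE// -expRD; congr expR; ring.
  rewrite -/(phi z) -/(phi (z - ln H)) => h.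
  by have := phistar_ge omegaW x y0; nra.
exists (ln H + H / (2 * l)) => [|p]; first by rewrite addr_ge0 ?divr_ge0//; lra.
rewrite !ln_Omega -mulrA.
have l2 : 0 < 2 * l by lra.
have p0 : (0 : R) <= p%:R by [].
have lp0 : 0 <= l * p%:R by rewrite mulr_ge0// ltW.
rewrite mulrC ler_pdivrMr//; apply: (le_trans (dbl _ lp0)).
have -> : (l^-1 * phistar (l * p%:R) + (ln H + H / (2 * l)) * p.+1%:R) * (2 * l) =
  2 * phistar (l * p%:R) + 2 * l * ln H * p.+1%:R + H * p.+1%:R.
  by field; rewrite gt_eqF.
have q1 : (1 : R) <= p.+1%:R by rewrite ler1n.
have : 0 <= l * ln H by rewrite mulr_ge0// ltW.
rewrite -(natr1 p) in q1 *; nra.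
Qed.

Lemma Omega_log_dom_le (l l' : R) : 0 < l -> l <= l' -> log_dom (Omega l) (Omega l').
Proof.
move=> l0 ll'; exists 0 => // p.
by rewrite mul0r addr0 ler_ln ?posrE ?expR_gt0// Omega_le.
Qed.

Lemma omega6_log_dom (l l' : R) : omega6 omega -> 0 < l -> 0 < l' ->
  log_dom (Omega l) (Omega l').
Proof.
move=> w6 l0 l'0.
have H n : log_dom (Omega (2 ^+ n * l')) (Omega l').
  elim: n => [|n IH]; first by rewrite mul1r; exact: log_dom_refl.
  apply: log_dom_trans IH; rewrite exprS -mulrA; apply: omega6_log_dom2 => //.
  by rewrite mulr_gt0// exprn_gt0.
pose n := (Num.truncn (l / l')).+1.
apply: log_dom_trans (H n); apply: Omega_log_dom_le => //.
rewrite -ler_pdivrMr//; apply: ltW; apply: lt_le_trans (truncnS_gt _) _.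
by rewrite -natrX ler_nat ltnW// ltn_expl.
Qed.

Lemma log_dom4_omega6 (l : R) : 0 < l -> log_dom (Omega (4 * l)) (Omega l) -> omega6 omega.
Proof.
move=> l0 [a a0 aP].
have l2 : 0 < (2 * l)^-1 by rewrite invr_gt0; lra.
have [C C0 CP] := weight_ln_le omegaW l2.
have key y : 0 <= y -> 2 * phi y <= phi (y + a) + 4 * l * (C + a).
  move=> y0; have [x x0 xP] := phi_young omegaW y0.
  pose j := Num.truncn (x / l).
  have /andP[jx xj] : j%:R <= x / l < j.+1%:R by apply: truncn_itv; rewrite divr_ge0// ltW.
  have {}jx : l * j%:R <= x by rewrite mulrC -ler_pdivlMr.
  have {}xj : x <= l * j%:R + l.
    by move: xj; rewrite ltr_pdivrMr// -(natr1 j); lra.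
  have px := phistar_mono jx.
  have := aP j; rewrite !ln_Omega.
  have l4 : 0 < 4 * l by lra.
  rewrite mulrC ler_pdivrMr//.
  have -> : (l^-1 * phistar (l * j%:R) + a * j.+1%:R) * (4 * l) =
    4 * phistar (l * j%:R) + 4 * l * a * j.+1%:R by field; rewrite gt_eqF.
  rewrite -(natr1 j) => aj.
  have ya : 0 <= y + a by exact: addr_ge0.
  have p4 := phistar_ge omegaW (4 * l * j%:R) ya.
  have ly : 2 * l * y <= phi y + 2 * l * C.
    have l20 : 0 <= 2 * l by lra.
    have := ler_wpM2l l20 (CP y y0).
    by rewrite mulrDr mulrA divff ?mul1r// gt_eqF//; lra.
  have xy : x * y <= (l * j%:R + l) * y by rewrite ler_wpM2r.
  by lra.
exists (expR a + 4 * l * (C + a)).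
have K0 : 0 <= 4 * l * (C + a) by rewrite mulr_ge0 ?addr_ge0//; lra.
have a1 : 1 <= expR a by rewrite -expR0 ler_expR.
split=> [|t t0]; first by lra.
set H := expR a + 4 * l * (C + a).
have H0 : 0 <= H by rewrite /H; lra.
have wH : 0 <= omega (H * t) by apply: (weight_ge0 omegaW); rewrite mulr_ge0.
have [t1|t1] := leP t 1.
  by rewrite (weight_eq0 omegaW) ?t0// mulr0 addr_ge0.
have := key (ln t); rewrite ln_ge0 ?(ltW t1)// => /(_ isT).
rewrite /Defs.phi expRD lnK ?posrE; last by lra.
have : omega (t * expR a) <= omega (H * t).
  apply: (weight_le omegaW); first by rewrite mulr_ge0// expR_ge0.
  by rewrite mulrC ler_wpM2r// /H lerDl.
by rewrite /H; lra.
Qed.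

Lemma E_fun_class_eq_log_dom b N : LC N -> class_eq (E_seq b N) (E_fun b omega) ->
  omega6 omega /\ forall l, 0 < l -> log_dom N (Omega l) /\ log_dom (Omega l) N.
Proof.
move=> LN /class_eqP[sub1 sub2]; have N0 := LC_gt0 LN.
have LO l : 0 < l -> LC (Omega l) := Omega_LC omegaW (l := l).
have O0 l k : 0 < Omega l k := expR_gt0 _.
suff H : (exists2 l, 0 < l & log_dom N (Omega l)) /\ (exists2 l, 0 < l & log_dom (Omega l) N)
    /\ ((forall l, 0 < l -> log_dom N (Omega l)) \/ (forall l, 0 < l -> log_dom (Omega l) N)).
  have [[l l0 Nl] [[m m0 mN] allN]] := H.
  have w6 : omega6 omega.
    case: allN => allN.
      apply: (@log_dom4_omega6 (m / 4)); first by lra.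
      have -> : 4 * (m / 4) = m by field.
      by apply: log_dom_trans mN _; apply: allN; lra.
    apply: (@log_dom4_omega6 l) => //.
    by apply: log_dom_trans Nl; apply: allN; lra.
  split=> [|k k0]; [exact: w6|split].
    exact: (log_dom_trans Nl (omega6_log_dom w6 l0 k0)).
  exact: (log_dom_trans (omega6_log_dom w6 k0 m0) mN).
case: b sub1 sub2 => sub1 sub2.
  have all l : 0 < l -> log_dom (Omega l) N.
    move=> l0; apply: (class_sub_log_dom (b := Roumieu)) => //; first exact: LO.
    move=> r s U oU U0 f fU; apply: sub2 => //; move: f fU.
    apply: E_fam_sub oU U0; [exact: geometric_fam_gt0|exact: Omega_gt0|] => h h0.
    have [L L1 LP] := Omega_absorb h0.
    by exists (L * l); [rewrite mulr_gt0//; lra|exact: LP].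
  split; last by split; [exists 1 => //; exact: all|right].
  have [l l0 [C C0 CP]] := E_Roumieu_sub_dom LN (@Omega_gt0 _ omega) sub1.
  by exists l => //; apply: (@seq_dom_log_dom _ _ _ 1 C) => // p; rewrite expr1n mulr1.
have all l : 0 < l -> log_dom N (Omega l).
  move=> l0; apply: (class_sub_log_dom (b := Beurling)) => //.
  move=> r s U oU U0 f fU; have {fU} := sub1 r s U oU U0 f fU; move: f.
  apply: E_fam_sub oU U0; [exact: Omega_gt0|exact: geometric_fam_gt0|] => h h0.
  exact: Omega_absorbed.
split; first by exists 1 => //; exact: all.
split; last by left.
have ji j : (0 : R) < j.+1%:R^-1 by rewrite invr_gt0.
have Mle i j k : (i <= j)%N -> Omega j.+1%:R^-1 k <= Omega i.+1%:R^-1 k.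
  by move=> ij; apply: (Omega_le omegaW) => //; rewrite lef_pV2 ?posrE// ler_nat ltnS.
have MW h : 0 < h -> exists j : nat, exists2 g, 0 < g &
    seq_dom (geometric_fam (Omega j.+1%:R^-1) g) (Omega h).
  move=> h0; exists (Num.truncn h^-1), 1 => //; exists 1 => // k.
  rewrite /geometric_fam expr1n !mul1r; apply: (Omega_le omegaW) => //.
  by rewrite -[leRHS]invrK lef_pV2 ?posrE ?invr_gt0// ltW// truncnS_gt.
have [j [A A0 AP]] := @E_Beurling_sub_dom _ (fun j => Omega j.+1%:R^-1) Omega
  (geometric_fam N) (fun j => LO _ (ji j)) Mle (@Omega_gt0 _ omega) (geometric_fam_gt0 N0) MW sub2.
exists j.+1%:R^-1 => //; apply: (@seq_dom_log_dom _ _ _ A A) => // p; rewrite -exprS.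
by have := AP p; rewrite /geometric_fam expr1n mul1r.
Qed.

Lemma omega6_class_eq b (l : R) : omega6 omega -> 0 < l ->
  class_eq (E_seq b (Omega l)) (E_fun b omega).
Proof.
move=> w6 l0; have O0 m k : 0 < Omega m k := expR_gt0 _.
apply/class_eqP; split; apply: E_fam_sub;
  [exact: geometric_fam_gt0|exact: Omega_gt0| |exact: Omega_gt0|exact: geometric_fam_gt0|].
  case: b => h h0.
    have [L L1 LP] := Omega_absorb h0.
    by exists (L * l); [rewrite mulr_gt0//; lra|exact: LP].
  have [a a0 aP] := log_dom_seq_dom (O0 l) (O0 h) (omega6_log_dom w6 l0 h0).
  exists a^-1; first by rewrite invr_gt0.
  have [|C C0 CP] := aP a^-1; first by rewrite invr_gt0.
  exists C => // k; have := CP k.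
  by rewrite mulVf ?gt_eqF// {2}/geometric_fam expr1n mul1r.
case: b => h h0.
  have [a a0 aP] := log_dom_seq_dom (O0 h) (O0 l) (omega6_log_dom w6 h0 l0).
  exists a => //; have [C C0 CP] := aP 1 ltr01.
  exists C => // k; have := CP k.
  by rewrite mul1r {1}/geometric_fam expr1n mul1r.
exact: Omega_absorbed.
Qed.

End WeightMatrix.

(** * Moderate growth, (beta_3) and comparison with factorials *)

Section ModerateGrowth.
Context {R : realType}.
Implicit Types M N : R^nat.

Definition log_mg M := exists2 a, 0 <= a &
  forall j k, ln (M (j + k)%N) <= ln (M j) + ln (M k) + a * (j + k).+1%:R.

Lemma log_mg_equiv N M : log_dom M N -> log_dom N M -> log_mg N -> log_mg M.
Proof.
move=> [a a0 MN] [c c0 NM] [d d0 Nmg].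
exists (a + 2 * c + d) => [|j k]; first by lra.
have := MN (j + k)%N; have := NM j; have := NM k; have := Nmg j k.
rewrite -(natr1 (j + k)) -(natr1 j) -(natr1 k) natrD.
have : (0 : R) <= j%:R by []; have : (0 : R) <= k%:R by [].
by nra.
Qed.

Lemma log_mg_mg M : (forall p, 0 < M p) -> M 0%N = 1 -> log_mg M -> mg M.
Proof.
move=> M0 M1 [a a0 aP]; exists (expR (2 * a)).
split=> [|j k]; first by rewrite -[leLHS]expR0 ler_expR; lra.
have [/eqP|jk0] := posnP (j + k)%N.
  by rewrite addn_eq0 => /andP[/eqP-> /eqP->]; rewrite M1 expr0 !mulr1.
rewrite -expRM_natr -[M (j + k)%N]lnK ?posrE// -[M j]lnK ?posrE// -[M k]lnK ?posrE//.
rewrite -!expRD ler_expR; have := aP j k.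
have : (1 : R) <= (j + k)%:R by rewrite ler1n.
by rewrite -natr1; nra.
Qed.

Lemma limn_einf_ge (u : R^nat) (c : R) n : (forall p, (n <= p)%N -> c <= u p) ->
  (c%:E <= limn_einf (fun p => (u p)%:E))%E.
Proof.
move=> cu; rewrite limn_einf_lim; apply: lime_ge; first exact: is_cvg_einfs.
near=> m; apply: le_ereal_inf_tmp => _ [p /= mp <-]; rewrite lee_fin; apply: cu.
by apply: leq_trans mp; near: m; exact: nbhs_infty_ge.
Unshelve. all: by end_near. Qed.

(* Moderate growth bounds [ln mu_p] above by [(ln M_p) / p] up to a constant,
   and log-convexity bounds [ln mu_(Qp)] below by [(ln M_(Qp)) / (Qp)]. *)
Lemma beta3_of_dilation M : LC M -> log_mg M ->
  (forall K : R, exists Q : nat, (0 < Q)%N /\ exists2 c, 0 <= c &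
    forall p, Q%:R * ln (M p) + K * (Q * p)%:R - c <= ln (M (Q * p)%N)) -> beta3 M.
Proof.
move=> LM [m m0 mP] dil; have M0 := LC_gt0 LM.
have q0 i := quotients_gt0 i LM.
have [Q [Q0 [c c0 cP]]] := dil (2 * m + 2).
exists Q; split=> //.
pose n := (Num.truncn (m + c)).+1.
apply: (@lt_le_trans _ _ 2%:E); first by rewrite lte_fin ltr1n.
apply: (@limn_einf_ge _ 2 n) => p np.
have pm : m + c <= p%:R by rewrite ltW// (lt_le_trans (truncnS_gt _))// ler_nat.
have p0 : (0 : R) < p%:R by rewrite ltr0n (leq_trans _ np).
have Q1 : (1 : R) <= Q%:R by rewrite ler1n.
have up : p%:R * ln (quotients M p) <= ln (M p) + m * (p + p).+1%:R.
  have := LC_quotients_le p (p + p) LM; rewrite exprD mulrA.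
  rewrite ler_pM2r ?exprn_gt0// => h.
  have : ln (M p * quotients M p ^+ p) <= ln (M (p + p)%N).
    by rewrite ler_ln ?posrE ?mulr_gt0 ?exprn_gt0.
  rewrite lnM ?posrE ?exprn_gt0// (lnXn _ (q0 p)) -mulr_natl.
  by have := mP p p; lra.
have down : ln (M (Q * p)%N) <= (Q * p)%:R * ln (quotients M (Q * p)%N).
  have := LC_quotients_le (Q * p) 0 LM; rewrite (LC_0 LM) expr0 mulr1 mul1r.
  by rewrite mulr_natl -(lnXn _ (q0 _)) ler_ln ?posrE ?exprn_gt0.
have key : 1 <= ln (quotients M (Q * p)%N) - ln (quotients M p).
  have Qp : 0 < Q%:R * p%:R :> R by rewrite mulr_gt0//; lra.
  rewrite -(ler_pM2l Qp).
  have := cP p; move: down up; rewrite natrM -natr1 natrD => down up cp.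
  have := ler_wpM2l (ltW (lt_le_trans ltr01 Q1)) up.
  have : Q%:R * (m + c) <= Q%:R * p%:R :> R by rewrite ler_wpM2l//; lra.
  have : c <= Q%:R * c by rewrite ler_peMl.
  lra.
rewrite ler_pdivlMr//.
rewrite -[quotients M (Q * p)%N]lnK ?posrE// -[quotients M p]lnK ?posrE//.
have : expR (1 + ln (quotients M p)) <= expR (ln (quotients M (Q * p)%N)).
  by rewrite ler_expR; lra.
apply: le_trans; rewrite expRD ler_wpM2r ?expR_ge0//.
by have := expR_ge1Dx (1 : R); lra.
Qed.

Definition fact_lower M (A : R) := exists2 D, 0 <= D &
  forall p, ln (p`!%:R) + A * p%:R - D <= ln (M p).

Lemma fact_lower_dom M N : log_dom M N ->
  exists a, forall A, fact_lower M A -> fact_lower N (A - a).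
Proof.
move=> [a a0 MN]; exists a => A [D D0 DP]; exists (D + a) => [|p]; first by lra.
have := MN p; have := DP p; rewrite -natr1; lra.
Qed.

Lemma nth_roots_over_fact_ge M A : (forall p, 0 < M p) -> fact_lower M A ->
  exists2 D, 0 <= D & forall p, (0 < p)%N ->
    expR (A - D / p%:R) <= nth_roots (over_fact M) p.
Proof.
move=> M0 [D D0 DP]; exists D => // p p0.
have f0 : (0 : R) < p`!%:R by rewrite ltr0n fact_gt0.
have p0' : (0 : R) < p%:R by rewrite ltr0n.
rewrite nth_rootsE ?divr_gt0// ler_expR /over_fact ln_div ?posrE//.
rewrite [leRHS]mulrC ler_pdivlMr// mulrBl divfK ?gt_eqF//.
by have := DP p; lra.
Qed.

Lemma limn_einf_over_fact M A : (forall p, 0 < M p) -> fact_lower M A ->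
  (0 < limn_einf (fun p => (nth_roots (over_fact M) p)%:E))%E.
Proof.
move=> M0 /(nth_roots_over_fact_ge M0)[D D0 DP].
apply: (@lt_le_trans _ _ (expR (A - D))%:E); first by rewrite lte_fin expR_gt0.
apply: (@limn_einf_ge _ _ 1) => p p1; apply: le_trans (DP p p1).
rewrite ler_expR lerD2l lerN2 ler_pdivrMr ?ltr0n// ler_peMr//.
by rewrite ler1n.
Qed.

Lemma cvgy_over_fact M : (forall p, 0 < M p) -> (forall A, fact_lower M A) ->
  nth_roots (over_fact M) @ \oo --> +oo.
Proof.
move=> M0 MA; apply/cvgryPge => A; have [D D0 DP] := nth_roots_over_fact_ge M0 (MA A).
near=> p.
have p0 : (0 < p)%N by near: p; exact: nbhs_infty_gt.
have pD : D <= p%:R by near: p; exact: nbhs_infty_ger.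
apply: le_trans (DP p p0); apply: le_trans (expR_ge1Dx _).
have : D / p%:R <= 1 by rewrite ler_pdivrMr ?ltr0n// mul1r.
by lra.
Unshelve. all: by end_near. Qed.

Lemma exprn_fact_le (s : R) p : 0 <= s -> s ^+ p / p`!%:R <= expR s.
Proof.
move=> s0; case: p => [|p]; first by rewrite expr0 fact0 divr1 -expR0 ler_expR.
by have := expR_ge1Dxn p s0; lra.
Qed.

Lemma leq_fact_expn m n : (n <= m)%N -> (n`! <= m ^ n)%N.
Proof.
elim: n => // n IH nm; rewrite factS expnS leq_mul//.
by apply: IH; exact: ltnW.
Qed.

Lemma phi_omega_seq_ub M y p : LC M -> p%:R * y - ln (M p) <= phi (omega_seq M) y.
Proof.
move=> LM; have M0 := LC_gt0 LM; rewrite /phi /omega_seq expR_gt0.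
have [D D0 DP] := LC_expr_le LM (expR_ge0 y) (@ltr01 R).
apply: sup_upper_bound.
  split; first by exists (ln (expR y ^+ 0 / M 0%N)), 0%N.
  exists (ln (D + 1)) => _ [q _ <-].
  rewrite ler_ln ?posrE ?divr_gt0 ?exprn_gt0 ?expR_gt0//; last by lra.
  rewrite ler_pdivrMr//; apply: (le_trans (DP q)); rewrite expr1n mul1r.
  by rewrite ler_wpM2r ?lerDl// ltW.
exists p => //.
by rewrite ln_div ?posrE ?exprn_gt0 ?expR_gt0// lnXn ?expR_gt0// expRK mulr_natl.
Qed.

Lemma phi_omega_seq_le M y B : LC M -> (forall p, p%:R * y - ln (M p) <= B) ->
  phi (omega_seq M) y <= B.
Proof.
move=> LM MB; have M0 := LC_gt0 LM; rewrite /phi /omega_seq expR_gt0.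
apply: ge_sup => [|_ [p _ <-]]; first by exists (ln (expR y ^+ 0 / M 0%N)), 0%N.
rewrite ln_div ?posrE ?exprn_gt0 ?expR_gt0// lnXn ?expR_gt0// expRK -mulr_natl.
exact: MB.
Qed.

Lemma coercive_omega_seq M : LC M -> coercive (omega_seq M).
Proof.
move=> LM x; pose p := (Num.truncn x).+1; exists (ln (M p)) => y y0.
have := phi_omega_seq_ub y p LM.
have : x * y <= p%:R * y by rewrite ler_wpM2r// ltW// truncnS_gt.
by lra.
Qed.

Lemma omega_seq_le M A : LC M -> fact_lower M A -> exists2 D, 0 <= D &
  forall t, 0 < t -> 0 <= omega_seq M t <= expR (- A) * t + D.
Proof.
move=> LM [D D0 DP]; exists D => // t t0.
have -> : omega_seq M t = phi (omega_seq M) (ln t) by rewrite /phi lnK.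
apply/andP; split.
  by have := phi_omega_seq_ub (ln t) 0 LM; rewrite mul0r (LC_0 LM) ln1 subr0.
apply: phi_omega_seq_le => // p.
have f0 : (0 : R) < p`!%:R by rewrite ltr0n fact_gt0.
have s0 : 0 < expR (- A) * t by rewrite mulr_gt0 ?expR_gt0.
have := exprn_fact_le p (ltW s0).
rewrite -[X in X <= _]lnK ?posrE ?divr_gt0 ?exprn_gt0// ler_expR.
have ls : ln (expR (- A) * t) = ln t - A by rewrite lnM ?posrE ?expR_gt0// expRK addrC.
rewrite ln_div ?posrE ?exprn_gt0// (lnXn _ s0) ls -[(ln t - A) *+ p]mulr_natl.
by have := DP p; lra.
Qed.

Lemma omega2_omega_seq M A : LC M -> fact_lower M A -> omega2 (omega_seq M).
Proof.
move=> LM /(omega_seq_le LM)[D D0 DP]; exists (expR (- A) + D), 1; split=> // t t1.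
have t0 : 0 < t by lra.
have /andP[w0 wt] := DP t t0.
by rewrite (ger0_norm w0) (gtr0_norm t0); nra.
Qed.

Lemma omega5_omega_seq M : LC M -> (forall A, fact_lower M A) -> omega5 (omega_seq M).
Proof.
move=> LM MA e e0; have e20 : 0 < e / 2 by lra.
have [D D0 DP] := omega_seq_le LM (MA (- ln (e / 2))).
exists (2 * D / e); split=> [|t Dt]; first exact: num_real.
have t0 : 0 < t by apply: le_lt_trans Dt; rewrite divr_ge0//; lra.
have /andP[w0] := DP t t0.
rewrite (ger0_norm w0) (gtr0_norm t0) opprK lnK ?posrE//.
by move: Dt; rewrite ltr_pdivrMr//; nra.
Qed.

End ModerateGrowth.

Section WeightGrowth.
Context {R : realType}.
Variable omega : R -> R.
Hypothesis omegaW : weight_function omega.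
Local Notation phi := (phi omega).
Local Notation phistar := (phistar omega).
Local Notation Omega := (Omega omega).

Lemma log_mg_Omega (l : R) : omega6 omega -> 0 < l -> log_mg (Omega l).
Proof.
move=> w6 l0; have [a a0 aP] := omega6_log_dom2 omegaW w6 l0.
exists (2 * a) => [|j k]; first by lra.
have h0 : 0 <= 2^-1 :> R by lra.
have h1 : 2^-1 <= 1 :> R by lra.
have := phistar_convex omegaW (2 * l * j%:R) (2 * l * k%:R) h0 h1.
have -> : 2^-1 * (2 * l * j%:R) + (1 - 2^-1) * (2 * l * k%:R) = l * (j + k)%:R.
  by rewrite natrD; field.
have li : 0 <= l^-1 by rewrite invr_ge0 ltW.
move=> /(ler_wpM2l li); have := aP j; have := aP k; rewrite !ln_Omega.
have -> : l^-1 * (2^-1 * phistar (2 * l * j%:R) + (1 - 2^-1) * phistar (2 * l * k%:R)) =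
  (2 * l)^-1 * phistar (2 * l * j%:R) + (2 * l)^-1 * phistar (2 * l * k%:R).
  by field; rewrite gt_eqF.
rewrite -(natr1 (j + k)) -(natr1 j) -(natr1 k) natrD.
have : 0 <= a * j%:R by rewrite mulr_ge0.
have : 0 <= a * k%:R by rewrite mulr_ge0.
by lra.
Qed.

Lemma beta3_log_equiv (M : R^nat) : LC M -> log_mg M ->
  log_dom M (Omega 1) -> log_dom (Omega 1) M -> beta3 M.
Proof.
move=> LM mgM [a a0 aP] [c c0 cP]; apply: beta3_of_dilation => // K.
have K0 : 0 <= `|K| + a + c by rewrite !addr_ge0.
have [C C1 CP] := phistar_dilate omegaW K0.
pose Q := (Num.truncn C).+1; exists Q; split=> //.
have CQ : C <= Q%:R by rewrite ltW// truncnS_gt.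
exists (Q%:R * a + Q%:R + c) => [|p]; first by rewrite !addr_ge0// mulr_ge0.
have := CP _ p%:R CQ; have := aP p; have := cP (Q * p)%N.
rewrite !ln_Omega invr1 !mul1r natrM -(natr1 p) -(natr1 (Q * p)) natrM => h1 h2 h3.
have Q0 : (0 : R) <= Q%:R by [].
have := ler_wpM2l Q0 h2.
have : K * (Q%:R * p%:R) <= `|K| * (Q%:R * p%:R) by rewrite ler_wpM2r ?mulr_ge0// ler_norm.
by lra.
Qed.

Lemma fact_lower_Omega (e A l : R) : 0 < e -> 0 < l ->
  (forall t, A < t -> `|omega t| <= e * `|t|) ->
  fact_lower (Omega l) (ln (l / e) - 1).
Proof.
move=> e0 l0 wA; have w0 : 0 <= omega `|A| by exact: (weight_ge0 omegaW).
have we y : phi y <= e * expR y + omega `|A|.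
  have [yA|Ay] := leP (expR y) A.
    have : phi y <= omega `|A|.
      by apply: (weight_le omegaW); rewrite ?expR_ge0// (le_trans yA)// ler_norm.
    have : 0 <= e * expR y by rewrite mulr_ge0 ?expR_ge0// ltW.
    by lra.
  have := wA _ Ay; rewrite (ger0_norm (expR_ge0 y)) (ger0_norm (phi_ge0 omegaW y)).
  by rewrite /Defs.phi; lra.
exists (omega `|A| / l) => [|p]; first by rewrite divr_ge0// ltW.
have wl : 0 <= omega `|A| / l by rewrite divr_ge0// ltW.
rewrite ln_Omega.
have ps : 0 <= l^-1 * phistar (l * p%:R).
  by rewrite mulr_ge0 ?invr_ge0 ?(phistar_ge0 omegaW)// ltW.
case: p ps => [|p] ps; first by rewrite fact0 ln1 mulr0; lra.
have p0 : (0 : R) < p.+1%:R by [].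
have le0 : 0 < l / e by rewrite divr_gt0.
have fp : ln (p.+1`!%:R : R) <= p.+1%:R * ln p.+1%:R.
  rewrite mulr_natl -lnXn// ler_ln ?posrE ?exprn_gt0 ?ltr0n ?fact_gt0// -natrX ler_nat.
  exact: leq_fact_expn.
pose y := ln (l / e * p.+1%:R).
have yE : y = ln (l / e) + ln p.+1%:R by rewrite /y lnM ?posrE.
suff : p.+1%:R * (y - 1) - omega `|A| / l <= l^-1 * phistar (l * p.+1%:R).
  by rewrite yE; lra.
have [y0|y0] := leP 0 y; last first.
  have : p.+1%:R * (y - 1) <= 0 by rewrite pmulr_rle0//; lra.
  by lra.
have := phistar_ge omegaW (l * p.+1%:R) y0; have := we y.
rewrite {2}/y lnK ?posrE ?mulr_gt0 ?invr_gt0//.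
have -> : e * (l / e * p.+1%:R) = l * p.+1%:R by field; rewrite gt_eqF.
move=> h1 h2; rewrite mulrC (mulrC l^-1) ler_pdivlMr// mulrBl divfK ?gt_eqF//.
by lra.
Qed.

Lemma omega2_fact_lower (l : R) : omega2 omega -> 0 < l ->
  exists A, fact_lower (Omega l) A.
Proof.
move=> [C [A [_ CA]]] l0; exists (ln (l / (`|C| + 1)) - 1).
have C0 : 0 < `|C| + 1 by rewrite ltr_wpDl.
apply: (fact_lower_Omega C0 l0 (A := A)) => t At; apply: (le_trans (CA t At)); rewrite ler_wpM2r//.
by have := ler_norm C; lra.
Qed.

Lemma omega5_fact_lower (l A : R) : omega5 omega -> 0 < l -> fact_lower (Omega l) A.
Proof.
move=> w5 l0; have e0 : 0 < l * expR (- (A + 1)) by rewrite mulr_gt0 ?expR_gt0.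
have [B [_ BP]] := w5 _ e0.
have := fact_lower_Omega e0 l0 BP.
have -> : l / (l * expR (- (A + 1))) = expR (A + 1).
  by rewrite invfM mulrA divff ?gt_eqF// mul1r expRN invrK.
by rewrite expRK addrK.
Qed.

Lemma E_fun_omega_seq b (N : R^nat) : LC N ->
  log_dom N (Omega 1) -> log_dom (Omega 1) N ->
  class_eq (E_fun b (omega_seq N)) (E_fun b omega).
Proof.
move=> LN [a a0 aP] [c c0 cP].
have cw := weight_coercive omegaW; have cN := coercive_omega_seq LN.
have lnO p : ln (Omega 1 p) = phistar p%:R by rewrite ln_Omega invr1 !mul1r.
have p0 y := phi_ge0 omegaW y.
have N0 y : 0 <= Defs.phi (omega_seq N) y.
  by have := phi_omega_seq_ub y 0 LN; rewrite mul0r (LC_0 LN) ln1 subr0.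
apply/class_eqP; rewrite !E_funE; split; apply: E_fam_sub; rewrite ?E_funE;
  try exact: Omega_gt0.
  have [C C1 CP] := phi_shift omegaW a.
  have h0 : 0 < (2 : R)^-1 by lra.
  have [K K0 KP] := weight_ln_le omegaW h0.
  apply: (@Omega_fam_le _ _ _ _ (2 * C + phi a + C * (2 * (K + a)) + C)) => // [|y y0].
    have : 0 <= C * (2 * (K + a)) by rewrite !mulr_ge0 ?addr_ge0//; lra.
    by have := p0 a; lra.
  set X := Defs.phi (omega_seq N) y; have X0 : 0 <= X := N0 y.
  have [ya|ay] := leP y a.
    have := phi_le omegaW ya; have := p0 a.
    have : 0 <= C * (2 * (K + a)) by rewrite !mulr_ge0 ?addr_ge0//; lra.
    by nra.
  have z0 : 0 <= y - a by lra.
  have [x x0 xP] := phi_young omegaW z0.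
  have /andP[jx xj] := truncn_itv x0; set j := Num.truncn x in jx xj.
  have px := phistar_mono omegaW jx.
  have := aP j; rewrite lnO => aj.
  have Xj : j%:R * y - ln (N j) <= X by exact: phi_omega_seq_ub.
  have xy : x * (y - a) <= j.+1%:R * (y - a) by rewrite ler_wpM2r// ltW.
  have ky := KP _ z0.
  have phz : phi (y - a) <= 2 * X + 2 * (K + a).
    by move: aj xy; rewrite -natr1; lra.
  have := CP (y - a); rewrite subrK.
  have : C * phi (y - a) <= C * (2 * X + 2 * (K + a)) by rewrite ler_wpM2l//; lra.
  have := p0 a; have : 0 <= C * (2 * (K + a)) by rewrite !mulr_ge0 ?addr_ge0//; lra.
  by nra.
have [C C1 CP] := phi_shift omegaW c.
apply: (@Omega_fam_le _ _ _ _ (C + c)) => // [|y y0]; first by lra.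
apply: phi_omega_seq_le => // p.
have yc : 0 <= y + c by exact: addr_ge0.
have := cP p; rewrite lnO -natr1.
have := phistar_ge omegaW p%:R yc; have := CP y; have := p0 y; nra.
Qed.

End WeightGrowth.

(** * The characterization *)

Section Characterization.
Context {R : realType}.
Variable omega : R -> R.
Hypothesis omegaW : weight_function omega.
Local Notation Omega := (Omega omega).

Lemma class_eq_Omega_equiv b (N : R^nat) (l : R) : LC N -> 0 < l ->
  class_eq (E_seq b (Omega l)) (E_seq b N) <-> equiv_seq N (Omega l).
Proof.
move=> LN l0; have LO := Omega_LC omegaW l0.
have N0 := LC_gt0 LN; have O0 := LC_gt0 LO.
rewrite class_eq_log_dom// /equiv_seq !preceqP//.
by split=> -[].
Qed.

Lemma all_log_dom_omega6 (N : R^nat) :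
  (forall l, 0 < l -> log_dom N (Omega l) /\ log_dom (Omega l) N) -> omega6 omega.
Proof.
move=> NO; apply: (log_dom4_omega6 omegaW ltr01).
have [_ O4] := NO (4 * 1) ltac:(by rewrite mulr1).
have [NO1 _] := NO 1 ltr01; exact: log_dom_trans O4 NO1.
Qed.

Lemma class_eq_of_log_dom b (N : R^nat) : LC N -> omega6 omega ->
  log_dom N (Omega 1) -> log_dom (Omega 1) N -> class_eq (E_seq b N) (E_fun b omega).
Proof.
move=> LN w6 NO ON.
have NO1 : class_eq (E_seq b N) (E_seq b (Omega 1)).
  by apply/class_eq_log_dom => //; exact: Omega_LC.
exact: class_eq_trans NO1 (omega6_class_eq omegaW b w6 ltr01).
Qed.

End Characterization.

Theorem theorem6p1 (R : realType) (b : bracket) (omega : R -> R)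
    (omegaW : weight_function omega) :
  let cond_i (N : R^nat) :=
    class_eq (E_seq b N) (E_fun b omega) /\
    class_eq (E_fun b omega) (E_mat b (Omega omega)) in
  let cond_iii (N : R^nat) :=
    forall l : R, 0 < l -> class_eq (E_seq b (Omega omega l)) (E_seq b N) in
  [/\ (exists N : R^nat, LC N /\ cond_i N) <-> omega6 omega,
      omega6 omega <-> (exists N : R^nat, LC N /\ cond_iii N),
      (forall N : R^nat, LC N -> forall l : R, 0 < l ->
         (class_eq (E_seq b (Omega omega l)) (E_seq b N)
          <-> equiv_seq N (Omega omega l))) &
      forall N : R^nat, LC N -> cond_i N \/ cond_iii N ->
        [/\ (* (a) *)
            mg N /\ (forall l : R, 0 < l -> mg (Omega omega l)),
            (* (b), first part *)
            (omega2 omega ->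
              [/\ (0 < limn_einf (fun p => (nth_roots (over_fact N) p)%:E))%E /\
                  (forall l : R, 0 < l ->
                    (0 < limn_einf (fun p =>
                       (nth_roots (over_fact (Omega omega l)) p)%:E))%E),
                  omega2 (omega_seq N) /\
                  (forall l : R, 0 < l -> omega2 (omega_seq (Omega omega l))),
                  beta3 N /\ (forall l : R, 0 < l -> beta3 (Omega omega l)) &
                  [/\ class_eq (E_fun b (omega_seq N)) (E_seq b N),
                      class_eq (E_seq b N) (E_fun b omega) &
                      forall l : R, 0 < l ->
                        class_eq (E_fun b omega) (E_seq b (Omega omega l))]]) &
            (* (b), second part *)
            (omega5 omega ->
              [/\ nth_roots (over_fact N) @ \oo --> +oo,
                  (forall l : R, 0 < l ->
                    nth_roots (over_fact (Omega omega l)) @ \oo --> +oo),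
                  omega5 (omega_seq N) &
                  forall l : R, 0 < l ->
                    omega5 (omega_seq (Omega omega l))])]].
Proof.
move=> cond_i cond_iii.
have LO l : 0 < l -> LC (Omega omega l) := Omega_LC omegaW (l := l).
have O0 l : 0 < l -> forall p, 0 < Omega omega l p := fun l0 => LC_gt0 (LO l l0).
have iiiP N : LC N -> cond_iii N -> forall l, 0 < l ->
    log_dom N (Omega omega l) /\ log_dom (Omega omega l) N.
  move=> LN h l l0; apply/(class_eq_log_dom b LN (LO l l0)).
  exact/class_eq_sym/h.
have condP N : LC N -> cond_i N \/ cond_iii N -> omega6 omega /\
    forall l, 0 < l -> log_dom N (Omega omega l) /\ log_dom (Omega omega l) N.
  move=> LN [[h _]|/(iiiP N LN) h]; first exact: E_fun_class_eq_log_dom h.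
  by split=> //; exact: all_log_dom_omega6 h.
have w6iii : omega6 omega -> cond_iii (Omega omega 1).
  move=> w6 l l0; apply/(class_eq_log_dom b (LO l l0) (LO 1 ltr01)).
  by split; exact: omega6_log_dom.
split.
- split=> [[N [LN Ni]]|w6]; first by have [] := condP N LN (or_introl Ni).
  exists (Omega omega 1); split; first exact: LO.
  by split; [exact: omega6_class_eq|exact: E_fun_mat].
- split=> [w6|[N [LN Niii]]]; last by have [] := condP N LN (or_intror Niii).
  by exists (Omega omega 1); split; [exact: LO|exact: w6iii].
- by move=> N LN l l0; exact: class_eq_Omega_equiv.
move=> N LN /(condP N LN)[w6 NO].
have [N1 O1] := NO 1 ltr01; have N0 := LC_gt0 LN.
have mgO l : 0 < l -> log_mg (Omega omega l) := log_mg_Omega omegaW w6 (l := l).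
have mgN : log_mg N := log_mg_equiv N1 O1 (mgO 1 ltr01).
have NW : class_eq (E_seq b N) (E_fun b omega) by exact: class_eq_of_log_dom.
split.
- split; first exact: log_mg_mg (LC_0 LN) mgN.
  by move=> l l0; exact: log_mg_mg (O0 l l0) (LC_0 (LO l l0)) (mgO l l0).
- move=> w2.
  have fO l : 0 < l -> exists A, fact_lower (Omega omega l) A.
    by move=> l0; exact: omega2_fact_lower.
  have [A fN] : exists A, fact_lower N A.
    have [A fA] := fO 1 ltr01; have [a aP] := fact_lower_dom O1.
    by exists (A - a); exact: aP.
  split.
  + split; first exact: limn_einf_over_fact fN.
    by move=> l l0; have [B fB] := fO l l0; exact: limn_einf_over_fact (O0 l l0) fB.
  + split; first exact: omega2_omega_seq fN.
    by move=> l l0; have [B fB] := fO l l0; exact: omega2_omega_seq (LO l l0) fB.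
  + split; first exact: (beta3_log_equiv omegaW).
    move=> l l0; apply: (beta3_log_equiv omegaW (LO l l0) (mgO l l0)).
      exact: omega6_log_dom.
    exact: omega6_log_dom.
  + split=> //.
      exact: class_eq_trans (E_fun_omega_seq omegaW b LN N1 O1) (class_eq_sym NW).
    by move=> l l0; apply: class_eq_sym; exact: omega6_class_eq.
move=> w5.
have fO A l : 0 < l -> fact_lower (Omega omega l) A.
  by move=> l0; exact: omega5_fact_lower.
have fN A : fact_lower N A.
  have [a aP] := fact_lower_dom O1.
  by have := aP _ (fO (A + a) 1 ltr01); rewrite addrK.
split.
- exact: cvgy_over_fact.
- by move=> l l0; apply: cvgy_over_fact (O0 l l0) _ => A; exact: fO.
- exact: omega5_omega_seq.
- by move=> l l0; apply: omega5_omega_seq (LO l l0) _ => A; exact: fO.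
Qed.
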